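(* To any $\Phi\in W^{2,\infty}(0,L)$ one can associate a sequence of functions $\Phi_{\varepsilon\delta}\in W^{2,\infty}\big(-\tfrac\delta2,L+\tfrac\delta2\big)$ such that, as $(\varepsilon,\delta)\to(0,0)$ with $\delta/\varepsilon\to0$, $$\Phi_{\varepsilon\delta}\to\Phi\ \text{ strongly in }H^1(0,L),$$ $$\frac\delta\varepsilon\mathcal T^{(2)}_{\varepsilon\delta}(d^2\Phi_{\varepsilon\delta})\to d^2\Phi\ \text{ strongly in }L^2(\omega\times Y_2),\qquad \frac\delta\varepsilon\mathcal T^{(1)}_{\varepsilon\delta}(d^2\Phi_{\varepsilon\delta})\to0\ \text{ strongly in }L^2(\omega\times Y_1),$$ where in the last two convergences $\Phi$ and $\Phi_{\varepsilon\delta}$ are regarded as functions of the variable $x_1$. Moreover, if $\Phi=d\Phi=0$ a.e. on $(0,l)$, then $\Phi_{\varepsilon\delta}=d\Phi_{\varepsilon\delta}=0$ a.e. on $(-\tfrac\delta2,l)$.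
   Context: Fix $0<l<L$; $\omega=(0,L)^2$. The parameters satisfy $0<3\delta<\varepsilon<1$, $N_\varepsilon=L/\varepsilon\in\mathbb N^*$, $l/\varepsilon\in\mathbb N^*$. $I=(-\tfrac12,\tfrac12)$. $d$ and $d^2$ denote first and second derivatives of functions of one variable. $Y_1=(0,1)\times I$, $Y_2=I\times(0,1)$, $[x'/\varepsilon]=(\lfloor x_1/\varepsilon\rfloor,\lfloor x_2/\varepsilon\rfloor)$. With $\omega^{(1)}_{\varepsilon\delta}=\bigcup_{q=0}^{N_\varepsilon}(-\tfrac\delta2,L+\tfrac\delta2)\times(q\varepsilon-\tfrac\delta2,q\varepsilon+\tfrac\delta2)$ and $\omega^{(2)}_{\varepsilon\delta}=\bigcup_{p=0}^{N_\varepsilon}(p\varepsilon-\tfrac\delta2,p\varepsilon+\tfrac\delta2)\times(-\tfrac\delta2,L+\tfrac\delta2)$: for $\psi$ measurable on $\omega^{(1)}_{\varepsilon\delta}$, $\mathcal T^{(1)}_{\varepsilon\delta}(\psi)(x',y')=\psi(\varepsilon[x'/\varepsilon]+\varepsilon y_1\mathbf e_1+\delta y_2\mathbf e_2)$ on $\omega\times Y_1$; for $\psi$ measurable on $\omega^{(2)}_{\varepsilon\delta}$, $\mathcal T^{(2)}_{\varepsilon\delta}(\psi)(x',y')=\psi(\varepsilon[x'/\varepsilon]+\delta y_1\mathbf e_1+\varepsilon y_2\mathbf e_2)$ on $\omega\times Y_2$. *)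

(* Defs.v *)
From HB Require Import structures.
From mathcomp Require Import all_boot all_order all_algebra.
From mathcomp Require Import all_classical all_reals all_analysis.
Set Implicit Arguments.
Unset Strict Implicit.
Unset Printing Implicit Defensive.
Import Order.TTheory GRing.Theory Num.Theory.
Import numFieldNormedType.Exports.
Local Open Scope classical_set_scope.
Local Open Scope ring_scope.

(** Functions on an open set D are represented by total functions restricted to
    D: [f \_ D] is f on D and 0 elsewhere.  Equivalence classes modulo a.e.
    equality are represented by (Borel) measurable functions. *)

Section Spaces.
Context {d : measure_display} {T : measurableType d} {R : realType}.
Variable m : {measure set T -> \bar R}.

Definition L_space (p : \bar R) (D : set T) (f : T -> R) : Prop :=
  f \_ D \in Lfun m p.

Definition L_norm (p : \bar R) (D : set T) (f : T -> R) : \bar R :=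
  Lnorm m p (EFin \o (f \_ D)).

Definition strong_cvg_L2 {I : Type} (F : set_system I) (D : set T)
    (u : I -> T -> R) (f : T -> R) : Prop :=
  [/\ L_space 2%:E D f,
      \forall i \near F, L_space 2%:E D (u i)
    & (L_norm 2%:E D (u i \- f) @[i --> F] --> 0%E)].

End Spaces.

(** The library's canonical sigma-finite structure on [m1 \x m2] is shadowed by
    the one for sub-probabilities, so it is restored here on an alias. *)
Section ProdMeasure.
Context {d1 d2 : measure_display} {T1 : measurableType d1}
  {T2 : measurableType d2} {R : realType}.
Variables (m1 : {sigma_finite_measure set T1 -> \bar R})
  (m2 : {sigma_finite_measure set T2 -> \bar R}).

Definition prod_measure : set (T1 * T2) -> \bar R := (m1 \x m2)%E.

HB.instance Definition _ := Measure.on prod_measure.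

Let prod_measure_sigma_finite : sigma_finite setT prod_measure.
Proof.
have /sigma_finiteP[F [TF ndF Foo]] := sigma_finiteT m1.
have /sigma_finiteP[G [TG ndG Goo]] := sigma_finiteT m2.
exists (fun n => F n `*` G n).
  rewrite -setXTT TF TG predeqE => -[x y]; split.
    move=> [/= [n _ Fnx] [k _ Gky]]; exists (maxn n k) => //; split.
    - by move: x Fnx; exact/subsetPset/ndF/leq_maxl.
    - by move: y Gky; exact/subsetPset/ndG/leq_maxr.
  by move=> [n _ []/= ? ?]; split; exists n.
move=> k; have [? ?] := Foo k; have [? ?] := Goo k.
split; first exact: measurableX.
by rewrite /prod_measure product_measure1E// lte_mul_pinfty// ge0_fin_numE.
Qed.

HB.instance Definition _ := Measure_isSigmaFinite.Build _ _ _ prod_measure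
  prod_measure_sigma_finite.

End ProdMeasure.

Section Sobolev.
Context {R : realType}.
Implicit Types (a b : R) (u g phi : R -> R).
Let mu := @lebesgue_measure R.

(** phi belongs to C_c^oo(a, b). *)
Definition test_function a b phi : Prop :=
  [/\ forall n x, derivable (phi^`(n))%classic x 1,
      compact (closure [set x | phi x != 0])
    & closure [set x | phi x != 0] `<=` `]a, b[].

Definition is_weak_derivative a b u g : Prop :=
  [/\ locally_integrable `]a, b[ u, locally_integrable `]a, b[ g
    & forall phi, test_function a b phi ->
        \int[mu]_(x in `]a, b[) (u x * phi^`()%classic x) =
        - \int[mu]_(x in `]a, b[) (g x * phi x)].

(** The weak derivative of u on (a, b): it is determined up to a.e. equality,
    and [xget] selects a representative (the junk value is 0 if there is none). *)
Definition weak_derivative a b u : R -> R :=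
  xget (cst 0) [set g | is_weak_derivative a b u g].

(** u belongs to W^{k,p}(a, b). *)
Fixpoint sobolev (k : nat) (p : \bar R) a b u : Prop :=
  L_space mu p `]a, b[ u /\
  if k is k'.+1 then
    exists2 g, is_weak_derivative a b u g & sobolev k' p a b g
  else True.

Definition H1_norm a b u : \bar R :=
  ((L_norm mu 2%:E `]a, b[ u ^+ 2 +
    L_norm mu 2%:E `]a, b[ (weak_derivative a b u) ^+ 2) `^ 2^-1)%E.

Definition strong_cvg_H1 {I : Type} (F : set_system I) a b
    (u : I -> R -> R) (f : R -> R) : Prop :=
  [/\ sobolev 1 2%:E a b f,
      \forall i \near F, sobolev 1 2%:E a b (u i)
    & (H1_norm a b (u i \- f) @[i --> F] --> 0%E)].

Definition zero_ae a b u : Prop := {ae mu, forall x, a < x < b -> u x = 0}.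

End Sobolev.

Section Unfolding.
Context {R : realType}.

Definition pos_integer (x : R) : Prop := exists2 n : nat, (0 < n)%N & x = n%:R.

Definition admissible (L l eps del : R) : Prop :=
  [/\ 0 < 3 * del, 3 * del < eps, eps < 1,
      pos_integer (L / eps) & pos_integer (l / eps)].

(** Admissible parameters (eps, del) -> (0, 0) with del / eps -> 0. *)
Definition to_zero (L l : R) : set_system (R * R) :=
  filter_from [set eta : R | 0 < eta] (fun eta =>
    [set q : R * R | [/\ admissible L l q.1 q.2,
       q.1 < eta, q.2 < eta & q.2 / q.1 < eta]]).

Global Instance to_zero_filter (L l : R) : Filter (to_zero L l).
Proof.
apply: filter_from_filter; first by exists 1; rewrite /= ltr01.
move=> e1 e2 /= e10 e20; exists (Num.min e1 e2); first by rewrite /= lt_min e10.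
by move=> q [adm]; rewrite /= !lt_min => /andP[? ?] /andP[? ?] /andP[? ?].
Qed.

(** omega = (0, L)^2, Y_1 = (0, 1) x I, Y_2 = I x (0, 1), I = (-1/2, 1/2). *)
Definition omega (L : R) : set (R * R) := `]0, L[ `*` `]0, L[.
Definition Y1 : set (R * R) := `]0, 1[ `*` `](- 2^-1), 2^-1[.
Definition Y2 : set (R * R) := `](- 2^-1), 2^-1[ `*` `]0, 1[.

Definition lebesgue_R2 :=
  prod_measure (@lebesgue_measure R) (@lebesgue_measure R).
Definition lebesgue_R2R2 := prod_measure lebesgue_R2 lebesgue_R2.

(** eps [t / eps] *)
Definition cell (eps t : R) : R := eps * (Num.floor (t / eps))%:~R.

(** The unfolding operators, at (z.1, z.2) = (x', y').  For (eps, del)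
    admissible, only the values of psi on omega^(1)_{eps,del} (resp.
    omega^(2)_{eps,del}) matter on omega x Y_1 (resp. omega x Y_2). *)
Definition unfold1 (eps del : R) (psi : R * R -> R) (z : (R * R) * (R * R)) : R :=
  psi (cell eps z.1.1 + eps * z.2.1, cell eps z.1.2 + del * z.2.2).

Definition unfold2 (eps del : R) (psi : R * R -> R) (z : (R * R) * (R * R)) : R :=
  psi (cell eps z.1.1 + del * z.2.1, cell eps z.1.2 + eps * z.2.2).

(** A function of one variable regarded as a function of x_1. *)
Definition of_x1 (f : R -> R) : R * R -> R := fun x => f x.1.

End Unfolding.

(* Main.v *)
Require Import Defs.
From HB Require Import structures.
From mathcomp Require Import all_boot all_order all_algebra.
From mathcomp Require Import all_classical all_reals all_analysis.
From mathcomp Require Import measurable_realfun ess_sup_inf ring lra.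
Set Implicit Arguments.
Unset Strict Implicit.
Unset Printing Implicit Defensive.
Import Order.TTheory GRing.Theory Num.Theory.
Import numFieldNormedType.Exports.
Local Open Scope classical_set_scope.
Local Open Scope ring_scope.
(** A function of W^{2,oo}(0,L) agrees almost everywhere with the primitive
    [G0] of a Lipschitz function [G1], itself the primitive of a bounded
    function [g].  The approximating sequence concentrates the second
    derivative on the strips [|t - p eps| < del / 2]: its density equals, on the
    strip of index [p], the constant
    [(G1 (p eps) - G1 ((p - 1) eps)) / del], and vanishes elsewhere
    ([concentrated]).  Integrating across the strip of index [p] raises the
    slope from [G1 ((p - 1) eps)] to [G1 (p eps)] ([slope_node]), so the slope
    stays within [O(eps)] of [G1] ([slope_close]) and the approximation within
    [O(eps)] of [G0], whence the convergence in H^1.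

    After multiplication by [del / eps], the unfolded density is bounded by the
    Lipschitz constant of [G1].  The second operator reads it inside the strips,
    where it equals the difference quotient of [G1] over a cell next to [x_1]
    ([concentrated_unfold2]); by Lebesgue's theorem [G1] is differentiable almost
    everywhere with derivative [g], so this tends to the second derivative of
    Phi ([difference_quotient_cvg]).  The first operator reads it between two
    consecutive strips, where it vanishes as soon as [del / eps] is small
    ([concentrated_unfold1]).  Dominated convergence gives both strong limits in
    L^2 ([strong_cvg_L2_transfer]).

    The increment attached to the strip at [p eps] is the one of the cell on its
    left.  This shift makes the last assertion true: the strip at [l] starts
    before [l], but its jump only involves [G1 l] and [G1 (l - eps)].

    A weak derivative is only known up to a null set, so all this requires its
    uniqueness ([weak_derivative_unique]), the fact that a function with zero
    weak derivative is constant ([du_bois_reymond]), the fact that a primitive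
    has the expected weak derivative ([weak_derivative_primitive]), and the fact
    that the unfolding maps pull null sets back to null sets ([null_unfold]).
    The first two rest on an explicit family of smooth bumps ([sbump]). *)

(** * Almost-everywhere statements *)

Lemma ae_mono d (T : measurableType d) (R : realType)
    (m : {measure set T -> \bar R}) (P Q : T -> Prop) :
  (forall x, P x -> Q x) -> {ae m, forall x, P x} -> {ae m, forall x, Q x}.
Proof.
move=> PQ [N [mN N0 sN]]; exists N; split=> // x nQx.
by apply: sN => /PQ.
Qed.

Lemma ae_and d (T : measurableType d) (R : realType)
    (m : {measure set T -> \bar R}) (P Q : T -> Prop) :
  {ae m, forall x, P x} -> {ae m, forall x, Q x} ->
  {ae m, forall x, P x /\ Q x}.
Proof.
move=> [A [mA A0 sA]] [B [mB B0 sB]]; exists (A `|` B); split.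
- exact: measurableU.
- by rewrite null_set_setU.
- by move=> x /= /not_andP[nP|nQ]; [left; exact: sA|right; exact: sB].
Qed.

(** * Smooth bump functions *)

Section Smooth.
Context {R : realType}.
Implicit Types (f g : R -> R).

(** The factor [t^-k] makes the family stable under differentiation; [k = 0]
    is the usual smooth function that is flat at [0]. *)
Definition flat (k : nat) (t : R) : R :=
  if 0 < t then t^-1 ^+ k * expR (- t^-1) else 0.

Lemma flatS k t : flat k.+1 t = t^-1 * flat k t.
Proof. by rewrite /flat; case: ifP => _; rewrite ?mulr0// exprS mulrA. Qed.

Lemma flat_ge0 k t : 0 <= flat k t.
Proof.
rewrite /flat; case: ifP => // t0.
by rewrite mulr_ge0 ?expR_ge0// exprn_ge0// invr_ge0 ltW.
Qed.

(** The linear bound, from [y ^ k.+1 <= k.+1! exp y], settles both continuity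
    and, through [flatS], differentiability at [0]. *)
Lemma flat_le k t : 0 <= t -> flat k t <= (k.+1)`!%:R * t.
Proof.
rewrite /flat; case: ifPn => [t0 _|_ t0]; last by rewrite mulr_ge0.
rewrite expRN ler_pdivrMr ?expR_gt0//.
have /(expR_ge1Dxn k) h : 0 <= t^-1 by rewrite invr_ge0 ltW.
have h2 : t^-1 ^+ k.+1 / k.+1`!%:R <= expR t^-1 by apply: le_trans h; rewrite lerDr.
have f0 : 0 < k.+1`!%:R :> R by rewrite ltr0n fact_gt0.
rewrite -ler_pdivrMl; last by rewrite mulr_gt0.
apply: le_trans h2; rewrite exprS le_eqVlt; apply/orP; left; apply/eqP.
by field; rewrite !gt_eqF.
Qed.

Lemma flat_gt0E k t : 0 < t -> flat k t = t^-1 ^+ k * expR (- t^-1).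
Proof. by rewrite /flat => ->. Qed.

Lemma flat_le0 k t : t <= 0 -> flat k t = 0.
Proof. by rewrite /flat ltNge => ->. Qed.

Lemma cvg_flat0 k : flat k h @[h --> 0^'] --> 0.
Proof.
apply/cvgr0Pnorm_lt => e e0; near=> h.
have [h0|h0] := leP h 0; first by rewrite flat_le0// normr0.
rewrite ger0_norm ?flat_ge0// (le_lt_trans (flat_le k (ltW h0)))//.
rewrite mulrC -ltr_pdivlMr ?ltr0n ?fact_gt0//.
near: h; apply: nbhs_dnbhs; apply: lt_nbhsl.
by rewrite divr_gt0// ltr0n fact_gt0.
Unshelve. all: by end_near. Qed.

Lemma is_derive_flat k (t : R) :
  is_derive t 1 (flat k) (flat k.+2 t - k%:R * flat k.+1 t).
Proof.
have [t0|t0|->] := ltgtP t 0.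
- have : is_derive t 1 (cst 0 : R -> R) (flat k.+2 t - k%:R * flat k.+1 t).
    by rewrite !flat_le0 ?ltW// mulr0 subr0; exact: is_derive_cst.
  apply: near_eq_is_derive; near=> s; rewrite flat_le0//.
  near: s; exact: lt_le_nbhsl.
- have tn0 : t != 0 by rewrite gt_eqF.
  have : is_derive t 1 (fun s : R => s^-1 ^+ k * expR (- s^-1))
     (flat k.+2 t - k%:R * flat k.+1 t).
    have iV := @is_deriveV R id t 1 1 tn0 (is_derive_id _ _).
    have iN : is_derive t 1 (fun s : R => - s^-1) (t ^- 2).
      by apply: is_derive_eq (is_deriveN iV) _; rewrite /GRing.scale/= mulr1 opprK.
    have iE := @is_derive1_comp _ expR (fun s : R => - s^-1) _ _ _
      (is_derive_expR _) iN.
    have := is_deriveM (is_deriveX k iV) iE; rewrite exprfctE.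
    move=> iM; refine (is_derive_eq iM _).
    rewrite !flat_gt0E// /GRing.scale/=.
    case: k {iM} => [|k]; first by rewrite expr0 mulr0n; field.
    by rewrite /= -mulr_natr !exprS; field.
  apply: near_eq_is_derive; near=> s; rewrite flat_gt0E//.
  near: s; exact: lt_nbhsr.
- have c0 : h^-1 *: (flat k (h *: 1 + 0) - flat k 0) @[h --> 0^'] --> (0 : R).
    rewrite [X in X @ _](_ : _ = flat k.+1); first exact: cvg_flat0.
    apply/funext => h; rewrite (flat_le0 _ (lexx 0)) subr0 addr0 flatS.
    by rewrite /GRing.scale/= mulr1.
  rewrite !(flat_le0 _ (lexx 0)) mulr0 subr0.
  apply: DeriveDef; first by apply/cvg_ex; exists 0.
  by apply/cvg_lim => //; exact: Rhausdorff.
Unshelve. all: by end_near. Qed.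

(** A class of functions closed under differentiation, so that one derivative
    for each of its members yields derivatives of all orders. *)
Inductive flat_algebra : (R -> R) -> Prop :=
| flat_affine k a b : flat_algebra (fun x => flat k (a * x + b))
| flat_add f g : flat_algebra f -> flat_algebra g -> flat_algebra (f \+ g)
| flat_mul f g : flat_algebra f -> flat_algebra g -> flat_algebra (f \* g)
| flat_scale a f : flat_algebra f -> flat_algebra (fun x => a * f x).

Lemma flat_algebra_derive f : flat_algebra f ->
  exists2 f', flat_algebra f' & forall x : R, is_derive x 1 f (f' x).
Proof.
elim=> {f} [k a b|f g _ [f' Af Df] _ [g' Ag Dg]|f g Af0 [f' Af Df] Ag0 [g' Ag Dg]|a f _ [f' Af Df]].
- exists (fun x => a * (flat k.+2 (a * x + b) + (- k%:R) * flat k.+1 (a * x + b))).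
    apply: flat_scale; apply: (flat_add (flat_affine _ _ _)).
    by apply: flat_scale; apply: flat_affine.
  move=> x; have ia : is_derive x 1 (fun x : R => a * x + b) a.
    by apply: is_derive_eq; rewrite /GRing.scale/=; ring.
  have := @is_derive1_comp _ (flat k) (fun x => a * x + b) _ _ _ (is_derive_flat _ _) ia.
  by rewrite mulrC mulNr.
- exists (f' \+ g'); first exact: flat_add.
  by move=> x; apply: is_deriveD.
- exists ((f \* g') \+ (g \* f')).
    by apply: flat_add; apply: flat_mul.
  by move=> x; apply: is_deriveM.
- exists (fun x => a * f' x); first exact: flat_scale.
  by move=> x; apply: is_deriveZ.
Qed.

Definition smooth f := forall n (x : R), derivable (f^`(n)%classic) x 1.

Lemma smooth_derive1 f : (forall x : R, derivable f x 1) -> smooth f^`()%classic -> smooth f.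
Proof.
move=> df sf [|n] x; first exact: df.
by move: (sf n x); rewrite /derive1n iterSr.
Qed.

Lemma smooth_continuous f : smooth f -> continuous f.
Proof. by move=> /(_ 0%N) sf x; apply: differentiable_continuous; exact/derivable1_diffP/sf. Qed.

Lemma smooth_derivable f : smooth f -> forall x : R, derivable f x 1.
Proof. by move=> /(_ 0%N). Qed.

Lemma derive1_smooth f : smooth f -> smooth f^`()%classic.
Proof. by move=> sf n x; have := sf n.+1 x; rewrite /derive1n iterSr. Qed.

Lemma flat_algebra_smooth f : flat_algebra f -> smooth f.
Proof.
move=> Af n x; suff : flat_algebra (f^`(n)%classic).
  by move=> /flat_algebra_derive[f' _ /(_ x)[]].
elim: n => [//|n /flat_algebra_derive[f' Af' df']].
rewrite derive1nS [X in flat_algebra X](_ : _ = f')//.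
by apply/funext => y; rewrite derive1E; have [_ ->] := df' y.
Qed.

(** A smooth function supported in [[c, d]] that increases to the indicator
    of [(c, d)] with [n]; this is why these bumps suffice as test functions. *)
Definition sbump (c d : R) n (x : R) :=
  flat 0 (n.+1%:R * (x - c)) * flat 0 (n.+1%:R * (d - x)).

Lemma flat0_le1 t : flat 0 t <= 1.
Proof.
rewrite /flat; case: ifP => // t0.
by rewrite expr0 mul1r expR_le1 oppr_le0 invr_ge0 ltW.
Qed.

Lemma sbump_ge0 c d n x : 0 <= sbump c d n x.
Proof. by rewrite mulr_ge0 ?flat_ge0. Qed.

Lemma sbump_le1 c d n x : sbump c d n x <= 1.
Proof. by rewrite mulr_ile1 ?flat_ge0 ?flat0_le1. Qed.

Lemma sbump_gt0 c d n x : c < x < d -> 0 < sbump c d n x.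
Proof.
move=> /andP[cx xd]; have h t : 0 < t -> 0 < flat 0 (n.+1%:R * t).
  move=> t0; have nt0 : 0 < n.+1%:R * t by rewrite mulr_gt0.
  by rewrite flat_gt0E// expr0 mul1r expR_gt0.
by rewrite /sbump mulr_gt0 ?h ?subr_gt0.
Qed.

Lemma sbump_eq0 c d n x : ~~ (c < x < d) -> sbump c d n x = 0.
Proof.
rewrite negb_and -!leNgt /sbump => /orP[h|h].
  by rewrite flat_le0 ?mul0r// pmulr_rle0// subr_le0.
by rewrite [X in _ * X]flat_le0 ?mulr0// pmulr_rle0// subr_le0.
Qed.

Lemma sbump_cvg c d x : c < x < d -> sbump c d n x @[n --> \oo] --> (1 : R).
Proof.
move=> /andP[cx xd].
have h (t : R) : 0 < t -> flat 0 (n.+1%:R * t) @[n --> \oo] --> (1 : R).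
  move=> t0; rewrite [X in X @ _](_ : _ = expR \o (fun n : nat => - (t^-1 * n.+1%:R^-1))); last first.
    by apply/funext => n /=; rewrite flat_gt0E ?mulr_gt0// expr0 mul1r invfM mulrC.
  rewrite -[in X in _ --> X](@expR0 R); apply: continuous_cvg; first exact: continuous_expR.
  rewrite -oppr0; apply: cvgN; rewrite -[X in _ --> X](mulr0 t^-1).
  by apply: cvgMr; exact: cvg_harmonic.
rewrite -[X in _ --> X](mulr1 1); apply: cvgM; apply: h; by rewrite subr_gt0.
Qed.

Lemma flat_algebra_sbump c d n : flat_algebra (sbump c d n).
Proof.
rewrite (_ : sbump c d n = (fun x => flat 0 (n.+1%:R * x + (- n.+1%:R * c))) \*
  (fun x => flat 0 (- n.+1%:R * x + n.+1%:R * d))).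
  by apply: flat_mul; apply: flat_affine.
by apply/funext => x /=; rewrite /sbump; congr (flat _ _ * flat _ _); ring.
Qed.

Lemma sbump_smooth c d n : smooth (sbump c d n).
Proof. by apply: flat_algebra_smooth; exact: flat_algebra_sbump. Qed.

Lemma test_function_itv a b c d f : a < c -> d < b ->
  smooth f -> (forall x, ~~ (c < x < d) -> f x = 0) -> test_function a b f.
Proof.
move=> ac db sf f0.
have sub : closure [set x | f x != 0] `<=` `[c, d].
  rewrite [X in _ `<=` X](_ : _ = closure `[c, d]); last first.
    by apply/closure_id; exact: itv_closed.
  apply: closureS => x /= fx; rewrite in_itv/=.
  have [/andP[/ltW -> /ltW ->//]|/f0 e] := boolP (c < x < d).
  by rewrite e eqxx in fx.
split => //.
- apply: (subclosed_compact _ (@segment_compact _ c d)) => //.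
  exact: closed_closure.
- apply: (subset_trans sub) => x /=; rewrite !in_itv/= => /andP[cx xd].
  by rewrite (lt_le_trans ac)// (le_lt_trans xd).
Qed.
End Smooth.
(** * The fundamental lemma of the calculus of variations *)

Section Fundamental.
Context {R : realType}.
Implicit Types (f g h : R -> R) (a b c d : R).
Notation mu := (@lebesgue_measure R).

Lemma bounded_on (T : Type) (D : set T) (f : T -> R) (M : R) :
  (forall x, D x -> `|f x| <= M) -> [bounded f x | x in D].
Proof.
move=> fM; exists M; split; first exact: num_real.
by move=> y My x /= Dx; rewrite (le_trans (fM _ Dx))// ltW.
Qed.

Lemma itv_finite_measure (i j : bool) a b :
  (mu [set` Interval (BSide i a) (BSide j b)] < +oo)%E.
Proof. by rewrite lebesgue_measure_itv; case: ifP => _; rewrite ?ltry// -EFinB ltry. Qed.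

Lemma bounded_integrable_itv (i j : bool) a b (f : R -> R) (M : R) :
  measurable_fun setT f ->
  (forall x, x \in Interval (BSide i a) (BSide j b) -> `|f x| <= M) ->
  mu.-integrable [set` Interval (BSide i a) (BSide j b)] (EFin \o f).
Proof.
move=> mf fM; apply: measurable_bounded_integrable => //.
- exact: itv_finite_measure.
- exact: measurable_funS mf.
- exact: bounded_on fM.
Qed.

Lemma locally_integrable_segment a b c d h : a < c -> d < b ->
  locally_integrable `]a, b[ h -> mu.-integrable `[c, d] (EFin \o h).
Proof.
move=> ac db [mh _ hK].
have sub : `[c, d] `<=` `]a, b[.
  by move=> x /=; rewrite !in_itv/= => /andP[cx xd]; rewrite (lt_le_trans ac)// (le_lt_trans xd).
apply/integrableP; split.
  by apply/measurable_EFinP; exact: measurable_funS mh.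
by have := hK _ sub (@segment_compact _ _ _).
Qed.

(** The support of [f] stays at a positive distance from the endpoints, where
    local integrability does not control [h]. *)
Lemma integrableM_supp a b c d h f (M : R) : a < c -> d < b ->
  locally_integrable `]a, b[ h -> measurable_fun setT f ->
  (forall x, `|f x| <= M) -> (forall x, ~~ (c < x < d) -> f x = 0) ->
  mu.-integrable `]a, b[ (EFin \o (fun x => h x * f x)).
Proof.
move=> ac db lh mf fM f0.
have ih : mu.-integrable `[c, d] (EFin \o (fun x => h x * f x)).
  rewrite (_ : EFin \o _ = (EFin \o h) \* (EFin \o f))%E; last first.
    by apply/funext => x /=; rewrite EFinM.
  apply: integrableMl => //; first exact: locally_integrable_segment lh.
  - exact: measurable_funS mf.
  - exact: (@bounded_on _ _ _ M).
have /integrable_mkcond := ih => /(_ (measurable_itv _)) ih'.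
apply: (integrableS measurableT) => //.
rewrite (_ : EFin \o _ = (EFin \o (fun x : R => (h x * f x)%R)) \_ `[c, d])//.
apply/funext => x; rewrite patchE; case: ifPn => //.
rewrite notin_setE/= in_itv/= => xcd; rewrite f0 ?mulr0//.
by apply/negP => /andP[cx xd]; apply: xcd; rewrite !ltW.
Qed.

Lemma measurable_smooth f : smooth f -> measurable_fun setT f.
Proof.
move=> sf; apply: continuous_measurable_fun; exact: smooth_continuous.
Qed.

Lemma sbump_norm_le1 c d n x : `|sbump c d n x| <= 1 :> R.
Proof. by rewrite ger0_norm ?sbump_ge0 ?sbump_le1. Qed.

Lemma integral_itv_supp a b c d f : a <= c -> d <= b ->
  (forall x, ~~ (c < x < d) -> f x = 0) ->
  \int[mu]_(x in `]a, b[) f x = \int[mu]_(x in `]c, d[) f x.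
Proof.
move=> ac db f0; rewrite Rintegral_mkcond [RHS]Rintegral_mkcond; congr Rintegral.
apply/funext => x; rewrite !patchE.
have [xcd|xcd] := boolP (x \in `]c, d[%classic).
  rewrite ifT//; move: xcd; rewrite !inE/= !in_itv/= => /andP[cx xd].
  by rewrite (le_lt_trans ac)// (lt_le_trans xd).
case: ifP => // _; apply: f0; move: xcd; rewrite notin_setE/= in_itv/=.
by move/negP.
Qed.

(** The bumps converge to the indicator of [(c, d)] and are at most [1], so
    dominated convergence applies with bound [|h|]. *)
Lemma null_bump_segment a b h : locally_integrable `]a, b[ h ->
  (forall c d n, a < c -> d < b ->
     \int[mu]_(x in `]a, b[) (h x * sbump c d n x) = 0) ->
  forall c d, a < c -> d < b -> \int[mu]_(x in `]c, d[) h x = 0.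
Proof.
move=> lh h0 c d ac db.
have ih := locally_integrable_segment ac db lh.
have iho : mu.-integrable `]c, d[ (EFin \o h).
  by apply: integrableS ih => //; exact: subset_itv_oo_cc.
have mh := measurable_int _ iho.
have [] := @dominated_convergence _ _ _ mu `]c, d[%classic (measurable_itv _)
  (fun n x => (h x * sbump c d n x)%:E) (EFin \o h) (abse \o (EFin \o h)).
- move=> n; apply/measurable_EFinP/measurable_funM; first exact/measurable_EFinP.
  have := measurable_smooth (@sbump_smooth R c d n); exact: measurable_funS.
- by [].
- apply: aeW => x /=; rewrite in_itv/= => xcd; apply: cvg_EFin; first exact: nearW.
  rewrite -[X in _ --> X]mulr1; apply: cvgMr; exact: sbump_cvg.
- exact: integrable_abse.
- apply: aeW => x n _; rewrite lee_fin normrM ler_piMr// sbump_norm_le1//.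
move=> _ _ /=.
under eq_fun => n.
  rewrite (_ : (\int[mu]_(x in _) _ = 0)%E); last first.
    have i1 : mu.-integrable `]c, d[ (fun x : R => (h x * sbump c d n x)%:E).
      have := integrableM_supp ac db lh (measurable_smooth (@sbump_smooth R c d n))
        (sbump_norm_le1 c d n) (@sbump_eq0 _ c d n).
      apply: integrableS => //.
      by apply: subset_itv; rewrite bnd_simp ltW.
    rewrite -[LHS]fineK; last exact: integrable_fin_num.
    rewrite -[fine _]/(\int[mu]_(x in `]c, d[) (h x * sbump c d n x)).
    rewrite -(integral_itv_supp (ltW ac) (ltW db)) ?h0//.
    by move=> x /sbump_eq0 ->; rewrite mulr0.
  over.
move=> /(cvg_lim (@ereal_hausdorff _)) => H.
by rewrite /Rintegral /= -H lim_cst.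
Qed.

(** By Lebesgue's theorem [h] is almost everywhere the derivative of its
    primitive, which is locally zero. *)
Lemma null_primitive_ae c d h : mu.-integrable `[c, d] (EFin \o h) ->
  (forall x, c < x < d -> \int[mu]_(t in `]c, x]) h t = 0) ->
  {ae mu, forall x, c < x < d -> h x = 0}.
Proof.
move=> ih h0; pose hk := h \_ `[c, d].
have ihk : mu.-integrable setT (EFin \o hk).
  have /integrable_mkcond := ih => /(_ (measurable_itv _)).
  by rewrite restrict_EFin.
have lhk := integrable_locally (measurable_itv _) ih.
have ihky y : mu.-integrable `]c, y] (EFin \o hk) by exact: integrableS ihk.
have := @FTC1 R hk (BRight c) ihky lhk.
apply: ae_mono.
move=> x H cxd; have /andP[cx xd] := cxd.
have [|_] := H; first exact: cx.
rewrite (_ : hk x = h x); last first.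
  by rewrite /hk patchE ifT// inE/= in_itv/= !ltW.
move=> <-; rewrite derive1E.
rewrite (@near_eq_derive _ _ _ _ (cst 0)) ?derive_cst//.
near=> y; rewrite /= -[RHS](h0 y).
  apply: eq_Rintegral => t; rewrite inE/= in_itv/= => /andP[ct ty].
  rewrite /hk patchE ifT// inE/= in_itv/= (ltW ct)/= (le_trans ty)//.
  by near: y; exact: lt_le_nbhsl.
apply/andP; split; near: y; [exact: lt_nbhsr|exact: lt_nbhsl].
Unshelve. all: by end_near. Qed.

(** [h] need not be integrable up to the endpoints: the open interval is
    exhausted by countably many segments. *)
Lemma null_segments_ae a b h : locally_integrable `]a, b[ h ->
  (forall c d, a < c -> d < b -> \int[mu]_(x in `]c, d[) h x = 0) ->
  {ae mu, forall x, a < x < b -> h x = 0}.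
Proof.
move=> lh h0; have [ba|ab] := leP b a.
  by apply: aeW => x /andP[ax xb]; move: (lt_trans ax xb); rewrite ltNge ba.
(* Distance of the [k]-th segment to the endpoints. *)
pose e (k : nat) := (b - a) / k.+1%:R.
have e0 k : 0 < e k by rewrite divr_gt0 ?subr_gt0.
have : {ae mu, forall x, forall k, a + e k < x < b - e k -> h x = 0}.
  apply: ae_foralln => k.
  have ac : a < a + e k by rewrite ltrDl.
  have db : b - e k < b by rewrite ltrBlDr ltrDl.
  have ih := locally_integrable_segment ac db lh.
  apply: null_primitive_ae => // x /andP[cx xd].
  rewrite -Rintegral_itv_bndo_bndc ?h0//; first by rewrite (lt_trans xd).
  apply: integrableS ih => //.
  by apply: subset_itv; rewrite bnd_simp// ltW.
apply: ae_mono.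
move=> x H /andP[ax xb].
have ece : e k @[k --> \oo] --> (0 : R).
  by rewrite -[X in _ --> X](mulr0 (b - a)); apply: cvgMr; exact: cvg_harmonic.
have m0 : 0 < Num.min (x - a) (b - x) by rewrite lt_min !subr_gt0 ax.
have /cvgr0Pnorm_lt/(_ _ m0)[k _ /(_ k (leqnn _))/=] := ece.
rewrite ger0_norm ?(ltW (e0 k))// lt_min => /andP[h1 h2].
apply: (H k); apply/andP; split; first by rewrite -ltrBrDl.
by rewrite ltrBrDl -ltrBrDr.
Qed.

Lemma null_bump_ae a b h : locally_integrable `]a, b[ h ->
  (forall c d n, a < c -> d < b ->
     \int[mu]_(x in `]a, b[) (h x * sbump c d n x) = 0) ->
  {ae mu, forall x, a < x < b -> h x = 0}.
Proof.
by move=> lh h0; apply: null_segments_ae => //; exact: null_bump_segment.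
Qed.

Lemma test_function_sbump a b c d n : a < c -> d < b ->
  test_function a b (sbump c d n).
Proof.
move=> ac db; apply: (test_function_itv ac db); first exact: sbump_smooth.
by move=> x; exact: sbump_eq0.
Qed.

Lemma integrableM_sbump a b c d n h : a < c -> d < b ->
  locally_integrable `]a, b[ h ->
  mu.-integrable `]a, b[ (EFin \o (fun x => h x * sbump c d n x)).
Proof.
move=> ac db lh.
exact: (integrableM_supp ac db lh (measurable_smooth (@sbump_smooth R c d n))
        (sbump_norm_le1 c d n) (@sbump_eq0 _ c d n)).
Qed.

(** Stated for two almost everywhere equal functions, because the derivative
    of an arbitrary representative is compared with that of a chosen one. *)
Lemma weak_derivative_unique a b u v g1 g2 :
  {ae mu, forall x, a < x < b -> u x = v x} ->
  is_weak_derivative a b u g1 -> is_weak_derivative a b v g2 ->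
  {ae mu, forall x, a < x < b -> g1 x = g2 x}.
Proof.
move=> uv [lu lg1 w1] [lv lg2 w2].
suff : {ae mu, forall x, a < x < b -> (g1 \- g2) x = 0}.
  apply: ae_mono.
  by move=> x /[apply] /eqP; rewrite subr_eq0 => /eqP.
apply: null_bump_ae; first exact: locally_integrableB.
move=> c d n ac db.
under eq_Rintegral do rewrite /= mulrBl.
rewrite RintegralB//; last 2 first.
- exact: integrableM_sbump.
- exact: integrableM_sbump.
have tb := test_function_sbump n ac db.
apply/eqP; rewrite subr_eq0 -eqr_opp -w1// -w2//; apply/eqP.
congr fine; apply: ae_eq_integral => //.
- apply/measurable_EFinP/measurable_funM; first by case: lu.
  have := measurable_smooth (derive1_smooth (@sbump_smooth R c d n)); exact: measurable_funS.
- apply/measurable_EFinP/measurable_funM; first by case: lv.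
  have := measurable_smooth (derive1_smooth (@sbump_smooth R c d n)); exact: measurable_funS.
move: uv; apply: ae_mono.
by move=> x H /=; rewrite in_itv/= => /H ->.
Qed.

Lemma Rintegral_setT_supp (D : set R) f : (forall x, ~ D x -> f x = 0) ->
  \int[mu]_(x in D) f x = \int[mu]_x f x.
Proof.
move=> f0; rewrite Rintegral_mkcond; congr Rintegral; apply/funext => x.
by rewrite patchE; case: ifPn => // /negP; rewrite inE => /f0.
Qed.

Lemma integrable_continuous_supp c d f : continuous f ->
  (forall x, ~~ (c < x < d) -> f x = 0) -> mu.-integrable setT (EFin \o f).
Proof.
move=> cf f0.
have : mu.-integrable `[c, d] (EFin \o f).
  apply: continuous_compact_integrable; first exact: segment_compact.
  by apply: continuous_subspaceT.
move=> /integrable_mkcond => /(_ (measurable_itv _)).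
rewrite (_ : _ \_ _ = EFin \o f)//.
apply/funext => x; rewrite patchE; case: ifPn => //.
rewrite notin_setE/= in_itv/= => xcd; rewrite f0//.
by apply/negP => /andP[cx xd]; apply: xcd; rewrite !ltW.
Qed.

(** The vanishing integral is what makes the primitive of [f] vanish to the
    right of its support. *)
Lemma primitive_test_function a b c d f : a < c -> d < b -> smooth f ->
  (forall x, ~~ (c < x < d) -> f x = 0) ->
  \int[mu]_(x in `]a, b[) f x = 0 ->
  exists2 rho, test_function a b rho & rho^`()%classic = f.
Proof.
move=> ac db sf f0 If.
have cf := smooth_continuous sf.
have intf := integrable_continuous_supp cf f0.
pose rho x := \int[mu]_(t in `]-oo, x]) f t.
have drho x : derivable rho x 1 /\ rho^`()%classic x = f x.
  apply: (@continuous_FTC1 R f -oo%O x (x + 1)); rewrite ?ltrDl//.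
  - by apply: integrableS intf.
  - by rewrite ltNyr.
  - exact: cf.
have drhoE : rho^`()%classic = f by apply/funext => x; have [] := drho x.
exists rho => //; apply: (test_function_itv ac db).
  by apply: smooth_derive1; [move=> x; have [] := drho x|rewrite drhoE].
move=> x; rewrite negb_and -!leNgt => /orP[xc|dx].
  rewrite /rho (@eq_Rintegral _ _ _ _ _ (cst 0)).
    by rewrite Rintegral_cst ?mul0r//.
  move=> t; rewrite inE/= in_itv/= => tx; rewrite f0// negb_and -!leNgt.
  by rewrite (le_trans tx xc).
rewrite /rho -If Rintegral_setT_supp; last first.
  move=> t /=; rewrite in_itv/= => /negP; rewrite -ltNge => xt.
  by rewrite f0// negb_and -!leNgt (le_trans dx (ltW xt)) orbT.
rewrite Rintegral_setT_supp// => t /=; rewrite in_itv/= => tab.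
rewrite f0//; apply/negP => /andP[ct td]; apply: tab.
by rewrite (lt_trans ac)// (lt_trans td).
Qed.

Lemma integrable_scale (D : set R) f k : measurable D ->
  mu.-integrable D (EFin \o f) -> mu.-integrable D (EFin \o (fun x => k * f x)).
Proof.
move=> mD iF.
rewrite (_ : EFin \o _ = (fun x => k%:E * (EFin \o f) x)%E); first exact: integrableZl.
by apply/funext => x /=; rewrite EFinM.
Qed.

(** The integral serves as a divisor when a bump is normalized. *)
Lemma integral_sbump_neq0 a b c d n : a <= c -> c < d -> d <= b ->
  \int[mu]_(x in `]a, b[) sbump c d n x != 0.
Proof.
move=> ac cd db; apply/eqP => I0.
have ib : mu.-integrable `]a, b[ (EFin \o sbump c d n).
  have := integrable_continuous_supp (smooth_continuous (@sbump_smooth R c d n))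
    (@sbump_eq0 _ c d n).
  exact: integrableS.
have : (\int[mu]_(x in `]a, b[) `|(EFin \o sbump c d n) x| = 0)%E.
  rewrite -[RHS](congr1 EFin I0) fineK; last exact: integrable_fin_num.
  by apply: eq_integral => x _ /=; rewrite ger0_norm ?sbump_ge0.
move=> /ae_eq_integral_abs -/(_ (measurable_itv _) (measurable_int _ ib)) [N [mN N0 sN]].
have sub : `]c, d[ `<=` N.
  move=> x; rewrite /= in_itv/= => /[dup] /(@sbump_gt0 _ c d n x) b0 /andP[cx xd].
  apply: sN => /= /(_ _) H; move: b0; rewrite -lte_fin.
  have /H/= -> : `]a, b[%classic x by rewrite /= in_itv/= (le_lt_trans ac)// (lt_le_trans xd).
  by rewrite ltxx.
have : (mu `]c, d[ <= mu N)%E by apply: le_measure => //; rewrite inE//; exact: measurable_itv.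
rewrite N0 lebesgue_measure_itv/= lte_fin cd -EFinB lee_fin subr_le0.
by rewrite leNgt cd.
Qed.

(** A bump minus a multiple of a fixed one has integral zero, hence is the
    derivative of a test function; thus [h] has the same weighted mean [k]
    against all bumps, and [h - k] is orthogonal to them. *)
Lemma du_bois_reymond a b h : a < b -> locally_integrable `]a, b[ h ->
  (forall phi, test_function a b phi ->
     \int[mu]_(x in `]a, b[) (h x * phi^`()%classic x) = 0) ->
  exists k, {ae mu, forall x, a < x < b -> h x = k}.
Proof.
move=> ab lh h0.
(* The fixed bump lives on the middle third of the interval. *)
pose c0 := a + (b - a) / 3; pose d0 := b - (b - a) / 3.
have ac0 : a < c0 by rewrite /c0; lra.
have cd0 : c0 < d0 by rewrite /c0 /d0; lra.
have db0 : d0 < b by rewrite /d0; lra.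
pose I f := \int[mu]_(x in `]a, b[) f x.
have bint c d n : mu.-integrable setT (EFin \o (sbump c d n)).
  apply: (integrable_continuous_supp _ (@sbump_eq0 _ c d n)).
  by apply: smooth_continuous; exact: sbump_smooth.
have binto c d n : mu.-integrable `]a, b[ (EFin \o (sbump c d n)).
  by have := bint c d n; apply: integrableS.
have K0 : I (sbump c0 d0 0%N) != 0 by apply: integral_sbump_neq0 => //; exact: ltW.
pose k := I (fun x => h x * sbump c0 d0 0%N x) / I (sbump c0 d0 0%N).
exists k.
have lk : locally_integrable `]a, b[ (cst k : R -> R).
  apply: open_integrable_locally; first exact: itv_open.
  by apply: (@bounded_integrable_itv _ _ _ _ _ `|k|).
suff : {ae mu, forall x, a < x < b -> (h \- cst k) x = 0}.
  apply: ae_mono.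
  by move=> x /[apply] /eqP; rewrite subr_eq0 => /eqP.
apply: null_bump_ae; first exact: locally_integrableB.
move=> c d n ac db.
under eq_Rintegral do rewrite /= mulrBl.
rewrite RintegralB//; [|exact: integrableM_sbump|exact: integrableM_sbump].
rewrite RintegralZl//.
pose f x := I (sbump c0 d0 0%N) * sbump c d n x - I (sbump c d n) * sbump c0 d0 0%N x.
pose c1 := Num.min c c0; pose d1 := Num.max d d0.
have [rho trho drho] : exists2 rho, test_function a b rho & rho^`()%classic = f.
  apply: (@primitive_test_function a b c1 d1).
  - by rewrite lt_min ac.
  - by rewrite gt_max db.
  - apply: flat_algebra_smooth; rewrite (_ : f =
      (fun x => I (sbump c0 d0 0%N) * sbump c d n x) \+
      (fun x => - I (sbump c d n) * sbump c0 d0 0%N x)).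
      by apply: flat_add; apply: flat_scale; exact: flat_algebra_sbump.
    by apply/funext => x; rewrite /f /= mulNr.
  - move=> x xcd; rewrite /f !sbump_eq0 ?mulr0 ?subr0//.
    + apply: contra xcd => /andP[cx xd].
      by rewrite gt_min cx orbT lt_max xd orbT.
    + by apply: contra xcd => /andP[cx xd]; rewrite gt_min cx lt_max xd.
  - rewrite /f RintegralB//.
    + rewrite !RintegralZl// -!/(I _); ring.
    + exact: integrable_scale.
    + exact: integrable_scale.
have := h0 _ trho; rewrite drho /f.
under eq_Rintegral do rewrite mulrBr mulrCA [X in _ - X]mulrCA.
rewrite RintegralB//; last 2 first.
- by apply: integrable_scale => //; exact: integrableM_sbump.
- by apply: integrable_scale => //; exact: integrableM_sbump.
rewrite !RintegralZl//; [|exact: integrableM_sbump|exact: integrableM_sbump].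
move=> /eqP; rewrite subr_eq0 => /eqP e.
rewrite /k; apply/eqP; rewrite subr_eq0; apply/eqP.
apply: (mulfI K0); rewrite e -!/(I _); field; exact: K0.
Qed.
End Fundamental.
(** * Primitives of locally bounded functions *)

Section Primitive.
Context {R : realType}.
Implicit Types (f g phi : R -> R) (a b c d x y t B M : R).
Notation mu := (@lebesgue_measure R).

(** This class is stable under taking primitives, and its members are
    integrable on every bounded interval, so that second primitives need no
    further hypothesis. *)
Definition locally_bounded_measurable g :=
  measurable_fun setT g /\
  forall B, exists M, forall x, `|x| <= B -> `|g x| <= M.
Local Notation lbm := locally_bounded_measurable.

Lemma lbm_bounded_itv g a b : lbm g ->
  exists2 M, 0 <= M & forall x, a <= x <= b -> `|g x| <= M.
Proof.
move=> [_ /(_ (Num.max `|a| `|b|))[M gM]]; exists (Num.max M 0).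
  by rewrite le_max lexx orbT.
move=> x /andP[ax xb]; rewrite le_max gM// ler_norml; apply/andP; split.
  rewrite (le_trans _ ax)// lerNl (le_trans (ler_norm (- a)))// normrN.
  by rewrite le_max lexx.
by rewrite (le_trans xb)// (le_trans (ler_norm b))// le_max lexx orbT.
Qed.

Lemma lbm_integrable g (i j : bool) a b : lbm g ->
  mu.-integrable [set` Interval (BSide i a) (BSide j b)] (EFin \o g).
Proof.
move=> lg; have [M _ gM] := lbm_bounded_itv a b lg.
apply: (@bounded_integrable_itv R i j a b g M); first by case: lg.
move=> x xab; apply: gM.
suff : x \in `[a, b] by rewrite in_itv.
by move: x xab; apply/subset_itvP/subset_itv; case: i j => -[]; rewrite bnd_simp.
Qed.

Definition primitive (x0 : R) g x := \int[mu]_(t in `]x0, x]) g t.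

Lemma primitive_le x0 g x : x <= x0 -> primitive x0 g x = 0.
Proof. by move=> xx0; rewrite /primitive set_itv_ge ?Rintegral_set0// bnd_simp -leNgt. Qed.

Lemma primitiveB x0 g x y : lbm g -> x0 <= x -> x <= y ->
  primitive x0 g y - primitive x0 g x = \int[mu]_(t in `]x, y]) g t.
Proof.
move=> lg x0x xy; apply: Rintegral_itvB; rewrite ?bnd_simp//.
exact: lbm_integrable.
Qed.

Lemma itv_integral_bound g x y M : lbm g -> x <= y ->
  (forall t, x < t <= y -> `|g t| <= M) ->
  `| \int[mu]_(t in `]x, y]) g t | <= M * (y - x).
Proof.
move=> lg xy gM.
have ig := lbm_integrable false false x y lg.
apply: (le_trans (le_normr_Rintegral _ ig)) => //.
apply: (@le_trans _ _ (\int[mu]_(t in `]x, y]) M)).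
  apply: le_Rintegral => //; first exact: integrable_norm.
  - apply: (@bounded_integrable_itv _ _ _ _ _ (cst M) `|M|) => //.
rewrite Rintegral_cst// [X in fine X](_ : _ = (y - x)%:E)//.
rewrite [LHS]lebesgue_measure_itv/= lte_fin.
by move: xy; rewrite le_eqVlt => /predU1P[->|->//]; rewrite ltxx subrr.
Qed.

Lemma primitive_lipschitz x0 g B : lbm g -> exists2 M, 0 <= M &
  forall x y, x <= B -> y <= B ->
  `|primitive x0 g y - primitive x0 g x| <= M * `|y - x|.
Proof.
move=> lg; have [M M0 gM] := lbm_bounded_itv x0 B lg; exists M => //.
suff H x y : x <= y -> y <= B -> `|primitive x0 g y - primitive x0 g x| <= M * `|y - x|.
  move=> x y xB yB; have [xy|/ltW yx] := leP x y; first exact: H.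
  by rewrite distrC [X in _ * X]distrC H.
move=> xy yB; rewrite (ger0_norm (x := y - x)) ?subr_ge0//.
have [x0x|/ltW xx0] := leP x0 x.
  rewrite primitiveB//; apply: itv_integral_bound => // t /andP[xt ty].
  by apply: gM; rewrite (le_trans x0x (ltW xt)) (le_trans ty).
rewrite (primitive_le _ xx0) subr0.
have [x0y|/ltW yx0] := leP x0 y; last first.
  by rewrite primitive_le// normr0 mulr_ge0// subr_ge0.
rewrite /primitive (le_trans (itv_integral_bound (M := M) _ _ _))//.
  by move=> t /andP[xt ty]; apply: gM; rewrite (ltW xt) (le_trans ty).
by rewrite ler_wpM2l// lerB.
Qed.

Lemma primitive_continuous x0 g : lbm g -> continuous (primitive x0 g).
Proof.
move=> lg x; have [M M0 H] := primitive_lipschitz x0 (x + 1) lg.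
have M1 : 0 < M + 1 by rewrite ltr_wpDl.
apply/cvgrPdist_lt => e e0; apply/nbhs_ballP.
exists (Num.min 1 (e / (M + 1))); first by rewrite /= lt_min ltr01 divr_gt0.
move=> y; rewrite /ball/= lt_min => /andP[h1 h].
apply: (le_lt_trans (H y x _ _)).
- by move: h1; rewrite ltr_distlC => /andP[_ /ltW].
- by rewrite lerDl.
- rewrite (@le_lt_trans _ _ ((M + 1) * `|x - y|))//.
    by rewrite ler_wpM2r// lerDl.
  by rewrite mulrC -ltr_pdivlMr.
Qed.

Lemma lbm_primitive c x0 g : lbm g -> lbm (fun x => c + primitive x0 g x).
Proof.
move=> lg; split.
  apply: measurable_funD; first exact: measurable_cst.
  by apply: continuous_measurable_fun; exact: primitive_continuous.
move=> B; have [M M0 H] := primitive_lipschitz x0 (Num.max B x0) lg.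
exists (`|c| + M * (B + `|x0|)) => x xB.
rewrite (le_trans (ler_normD _ _))// lerD2l.
rewrite -[primitive _ _ _]subr0 -(@primitive_le x0 g x0)//.
rewrite (le_trans (H _ _ _ _))//; first by rewrite le_max lexx orbT.
  by rewrite le_max (le_trans (ler_norm x)).
by rewrite ler_wpM2l// (le_trans (ler_normB _ _))// lerD2r.
Qed.

Lemma lbm_locally_integrable a b g : lbm g -> locally_integrable `]a, b[ g.
Proof.
move=> lg; apply: open_integrable_locally; first exact: itv_open.
exact: lbm_integrable.
Qed.

Lemma test_function_eq0 a b phi x : test_function a b phi -> ~~ (a < x < b) ->
  phi x = 0 /\ phi^`()%classic x = 0.
Proof.
move=> [sphi _ supp] xab.
have nx : ~ closure [set y | phi y != 0] x.
  by move/supp; rewrite /= in_itv/=; exact/negP.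
have n0 : \forall y \near x, phi y = 0.
  have : nbhs x (~` closure [set y | phi y != 0]).
    by apply: open_nbhs_nbhs; split => //; apply: closed_openC; exact: closed_closure.
  apply: filterS => y; apply: contra_notP => /eqP phiy; exact: subset_closure.
split; first exact: nbhs_singleton n0.
by rewrite derive1E (@near_eq_derive _ _ _ _ (cst 0)) ?derive_cst.
Qed.

Lemma test_function_bounded a b phi : a < b -> test_function a b phi ->
  exists2 M, 0 <= M & forall x, `|phi^`()%classic x| <= M.
Proof.
move=> ab tphi.
have sphi : smooth phi by case: tphi.
have cphi' : continuous (Num.norm \o phi^`()%classic).
  move=> x; apply: continuous_comp; last exact: norm_continuous.
  by apply: smooth_continuous; exact: derive1_smooth.
have [|c _ phic] := @EVT_max R (Num.norm \o phi^`()%classic) a b (ltW ab).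
  exact: continuous_subspaceT.
exists `|phi^`()%classic c|; first exact: normr_ge0.
move=> x; have [xab|] := boolP (a < x < b).
  apply: phic; case/andP: xab => ax xb; by rewrite in_itv/= !ltW.
by move=> /(test_function_eq0 tphi)[_ ->]; rewrite normr0.
Qed.

(** Only the lower endpoint contributes, as a test function vanishes at [b]. *)
Lemma FTC2_test_function a b phi t : test_function a b phi -> t < b ->
  \int[mu]_(x in `[t, b]) phi^`()%classic x = - phi t.
Proof.
move=> tphi tb; have sphi : smooth phi by case: tphi.
have cphi := smooth_continuous sphi.
have phib : phi b = 0.
  by have [|] := @test_function_eq0 _ _ _ b tphi; rewrite // ltxx andbF.
rewrite /Rintegral (@continuous_FTC2 R _ phi)//; last 2 first.
- apply: continuous_subspaceT; apply: smooth_continuous; exact: derive1_smooth.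
- split; first by move=> x _; exact: smooth_derivable.
  + by apply: cvg_at_right_filter; exact: cphi.
  + by apply: cvg_at_left_filter; exact: cphi.
by rewrite -EFinB/= phib sub0r.
Qed.

Lemma EFin_Rintegral_restrict (D : set R) f : measurable D ->
  mu.-integrable D (EFin \o f) ->
  (\int[mu]_(x in D) f x)%:E = (\int[mu]_x ((f \_ D) x)%:E)%E.
Proof.
move=> mD iF; rewrite /Rintegral fineK; last exact: integrable_fin_num.
by rewrite integral_mkcond restrict_EFin.
Qed.

(** Fubini's theorem on the triangle [t <= x]: the integral of
    [phi' (x) g (t)] is computed first in [t], which gives the primitive, and
    first in [x], which gives [- phi (t)]. *)
Lemma weak_derivative_primitive c x0 g a b : lbm g -> x0 <= a ->
  is_weak_derivative a b (fun x => c + primitive x0 g x) g.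
Proof.
move=> lg x0a; have lG := lbm_primitive c x0 lg.
split; [exact: lbm_locally_integrable|exact: lbm_locally_integrable|].
move=> phi tphi; have [ba|ab] := leP b a.
  by rewrite !set_itv_ge ?Rintegral_set0 ?oppr0// bnd_simp -leNgt.
have sphi : smooth phi by case: tphi.
have cphi := smooth_continuous sphi.
have cphi' := smooth_continuous (derive1_smooth sphi).
have mphi' : measurable_fun setT phi^`()%classic by exact: measurable_smooth (derive1_smooth sphi).
have [K K0 phiK] := test_function_bounded ab tphi.
have [M M0 gM] := lbm_bounded_itv x0 b lg.
(* Truncation makes the integrand bounded and of bounded support in both
   variables. *)
pose gb := g \_ `]x0, b[.
have mgb : measurable_fun setT gb.
  apply/(measurable_restrictT _ _).1 => //; exact: measurable_funS lg.1.
have gbM t : `|gb t| <= M.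
  rewrite /gb patchE; case: ifPn => [|_]; last by rewrite normr0.
  by rewrite inE/= in_itv/= => /andP[? ?]; apply: gM; rewrite !ltW.
(* The integrand of Fubini's theorem: first component [x], second [t]. *)
pose k (p : R * R) := if p.2 <= p.1 then phi^`()%classic p.1 * gb p.2 else 0.
have mk : measurable_fun setT k.
  apply: measurable_fun_ifT => //.
    by apply: measurable_fun_ler; [exact: measurable_snd|exact: measurable_fst].
  apply: measurable_funM.
    by apply: (measurableT_comp mphi'); exact: measurable_fst.
  by apply: (measurableT_comp mgb); exact: measurable_snd.
have ik : (mu \x mu)%E.-integrable setT (EFin \o k).
  have : (mu \x mu)%E.-integrable (`]a, b[ `*` `]x0, b[) (EFin \o k).
    apply: measurable_bounded_integrable.
    - by apply: measurableX; exact: measurable_itv.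
    - rewrite [X in (X < _)%E](_ : _ = (mu `]a, b[ * mu `]x0, b[)%E).
        apply: lte_mul_pinfty; rewrite ?measure_ge0 ?itv_finite_measure//.
        by rewrite ge0_fin_numE// itv_finite_measure.
      by apply: product_measure1E; exact: measurable_itv.
    - by move: mk; exact: measurable_funS.
    - apply: (@bounded_on _ _ _ _ (K * M)) => -[x t] _; rewrite /k/=.
      case: ifP => _; last by rewrite normr0 mulr_ge0.
      by rewrite normrM ler_pM.
  move=> /integrable_mkcond => /(_ (measurableX (measurable_itv _) (measurable_itv _))).
  rewrite (_ : _ \_ _ = EFin \o k)//.
  apply/funext => -[x t]; rewrite patchE; case: ifPn => //.
  rewrite notin_setE/= !in_itv/= => /not_andP xt; rewrite /k/=; case: ifP => // tx.
  case: xt => [/negP xt|/negP xt].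
    by have [_ ->] := test_function_eq0 tphi xt; rewrite mul0r.
  rewrite /gb patchE ifF ?mulr0//; apply/negbTE; rewrite notin_setE/= in_itv/=.
  exact/negP.
have := Fubini ik.
have -> : (\int[mu]_x \int[mu]_y (EFin \o k) (x, y) =
          \int[mu]_x (phi^`()%classic x * primitive x0 g x)%:E)%E.
  apply: eq_integral => x _.
  have [xab|xab] := boolP (a < x < b); last first.
    have [_ e] := test_function_eq0 tphi xab.
    rewrite e mul0r; apply: integral0_eq => y _; rewrite /k/= e mul0r.
    by case: ifP.
  rewrite -RintegralZl//; last exact: lbm_integrable.
  rewrite EFin_Rintegral_restrict//; last first.
    by apply: integrable_scale => //; exact: lbm_integrable.
  apply: eq_integral => t _; rewrite /k/= /gb !patchE.
  case/andP: xab => ax xb.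
  have [tx|xt] := leP t x.
    case: (ifPn (t \in `]x0, x]%classic)) => [|].
      rewrite inE/= in_itv/= => /andP[h _]; rewrite ifT//.
      by rewrite inE/= in_itv/= h (le_lt_trans tx).
    rewrite notin_setE/= in_itv/= tx andbT => /negP h; rewrite ifF ?mulr0//.
    by apply/negbTE; rewrite notin_setE/= in_itv/= (negbTE h).
  rewrite ifF//; apply/negbTE; rewrite notin_setE/= in_itv/=.
  by rewrite leNgt xt andbF.
have -> : (\int[mu]_y \int[mu]_x (EFin \o k) (x, y) =
          \int[mu]_t (- (gb t * phi t))%:E)%E.
  apply: eq_integral => t _.
  have [tb|bt] := ltP t b; last first.
    have -> : gb t = 0.
      by rewrite /gb patchE ifF//; apply/negbTE; rewrite notin_setE/= in_itv/= [t < b]ltNge bt andbF.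
    rewrite mul0r oppr0; apply: integral0_eq => x _; rewrite /k/=; case: ifP => // tx.
    by rewrite /gb patchE ifF ?mulr0//; apply/negbTE; rewrite notin_setE/= in_itv/= [t < b]ltNge bt andbF.
  rewrite -mulrN -(FTC2_test_function tphi tb) -RintegralZl//; last first.
    apply: continuous_compact_integrable; first exact: segment_compact.
    exact: continuous_subspaceT.
  rewrite EFin_Rintegral_restrict//; last first.
    apply: integrable_scale => //.
    apply: continuous_compact_integrable; first exact: segment_compact.
    exact: continuous_subspaceT.
  apply: eq_integral => x _; rewrite /k/= patchE.
  case: ifPn => tx.
    case: (ifPn (x \in `[t, b]%classic)) => [_|]; first by rewrite mulrC.
    rewrite notin_setE/= in_itv/= tx/= => /negP; rewrite -ltNge => bx.
    have [|_ ->] := @test_function_eq0 _ _ _ x tphi; last by rewrite mul0r.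
    by rewrite negb_and -leNgt -leNgt (ltW bx) orbT.
  by rewrite ifF//; apply/negbTE; rewrite notin_setE/= in_itv/= (negbTE tx).
move=> /(congr1 fine); rewrite -!/(Rintegral _ _ _) => E.
have iphi' : mu.-integrable setT (EFin \o phi^`()%classic).
  apply: (@integrable_continuous_supp _ a b) => // x xab.
  by have [] := test_function_eq0 tphi xab.
have iphi'o : mu.-integrable `]a, b[ (EFin \o phi^`()%classic).
  by apply: integrableS iphi'.
under eq_Rintegral do rewrite mulrDl.
rewrite RintegralD//; last 2 first.
- exact: integrable_scale.
- rewrite (_ : EFin \o _ = (EFin \o primitive x0 g) \* (EFin \o phi^`()%classic))%E; last first.
    by apply/funext => x /=; rewrite EFinM.
  apply: integrableMl => //.
  + have := lbm_primitive 0 x0 lg => /(@lbm_integrable _ false true a b).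
    by congr (_ .-integrable _ _); apply/funext => x /=; rewrite add0r.
  + exact: measurable_funS mphi'.
  + exact: (@bounded_on _ _ _ _ K).
rewrite RintegralZl//.
have -> : \int[mu]_(x in `]a, b[) phi^`()%classic x = 0.
  rewrite Rintegral_itv_obnd_cbnd// Rintegral_itv_bndo_bndc; last first.
    by apply: integrableS iphi'.
  rewrite (FTC2_test_function tphi ab).
  by have [|-> _] := @test_function_eq0 _ _ _ a tphi; rewrite ?oppr0// ltxx.
rewrite mulr0 add0r.
have -> : \int[mu]_(x in `]a, b[) (primitive x0 g x * phi^`()%classic x) =
   \int[mu]_x (phi^`()%classic x * primitive x0 g x).
  under eq_Rintegral do rewrite mulrC.
  apply: Rintegral_setT_supp => x /=; rewrite in_itv/= => /negP xab.
  by have [_ ->] := test_function_eq0 tphi xab; rewrite mul0r.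
rewrite E.
have -> : \int[mu]_(x in `]a, b[) (g x * phi x) = \int[mu]_x (gb x * phi x).
  rewrite -[RHS](@Rintegral_setT_supp _ `]a, b[%classic); last first.
    move=> x /=; rewrite in_itv/= => /negP xab.
    by have [-> _] := test_function_eq0 tphi xab; rewrite mulr0.
  apply: eq_Rintegral => x; rewrite inE/= in_itv/= => /andP[ax xb].
  by rewrite /gb patchE ifT// inE/= in_itv/= (le_lt_trans x0a)// xb.
under eq_Rintegral do rewrite -mulN1r.
rewrite RintegralZl ?mulN1r//.
rewrite (_ : EFin \o _ = (EFin \o gb) \* (EFin \o phi))%E; last first.
  by apply/funext => x /=; rewrite EFinM.
apply: integrableMr => //.
- exact: (@bounded_on _ _ _ _ M).
- apply: (@integrable_continuous_supp _ a b) => // x xab.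
  by have [] := test_function_eq0 tphi xab.
Qed.
End Primitive.
(** * Representatives of Sobolev functions *)

Section Representation.
Context {R : realType}.
Implicit Types (f g u v phi : R -> R) (a b c d x y t B M : R).
Notation mu := (@lebesgue_measure R).

Lemma ae_eq_Rintegral (D : set R) u v : measurable D ->
  measurable_fun D u -> measurable_fun D v ->
  {ae mu, forall x, D x -> u x = v x} ->
  \int[mu]_(x in D) u x = \int[mu]_(x in D) v x.
Proof.
move=> mD mu' mv uv; congr fine; apply: ae_eq_integral => //.
- exact/measurable_EFinP.
- exact/measurable_EFinP.
- by move: uv; apply: ae_mono => x /[apply] ->.
Qed.

Lemma weak_derivative_ae_eq a b u v g :
  {ae mu, forall x, a < x < b -> u x = v x} ->
  locally_integrable `]a, b[ u -> is_weak_derivative a b v g ->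
  is_weak_derivative a b u g.
Proof.
move=> uv lu [lv lg w]; split=> // phi tphi.
have mphi' : measurable_fun setT phi^`()%classic.
  by apply: measurable_smooth; apply: derive1_smooth; case: tphi.
rewrite -w//; apply: ae_eq_Rintegral => //.
- apply: measurable_funM; [by case: lu|exact: measurable_funS mphi'].
- apply: measurable_funM; [by case: lv|exact: measurable_funS mphi'].
move: uv; apply: ae_mono.
by move=> x H; rewrite /= in_itv/= => /H ->.
Qed.

Lemma weak_derivativeP a b u g : is_weak_derivative a b u g ->
  is_weak_derivative a b u (weak_derivative a b u).
Proof. by move=> w; rewrite /weak_derivative; case: xgetP => [y -> //|/(_ g)]. Qed.

(** The representative selected by [weak_derivative] is unknown; it is
    identified, almost everywhere, from any function [v] whose weak derivative
    is known. *)
Lemma weak_derivative_eq a b u v g :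
  {ae mu, forall x, a < x < b -> u x = v x} ->
  locally_integrable `]a, b[ u -> is_weak_derivative a b v g ->
  is_weak_derivative a b u (weak_derivative a b u) /\
  {ae mu, forall x, a < x < b -> weak_derivative a b u x = g x}.
Proof.
move=> uv lu w; have /weak_derivativeP wu := weak_derivative_ae_eq uv lu w.
by split => //; exact: weak_derivative_unique uv wu w.
Qed.

Lemma integrableM_test_derive a b u phi : a < b -> test_function a b phi ->
  mu.-integrable `]a, b[ (EFin \o u) ->
  mu.-integrable `]a, b[ (EFin \o (fun x => u x * phi^`()%classic x)).
Proof.
move=> ab tphi iu; have [M M0 phiM] := test_function_bounded ab tphi.
have mphi' : measurable_fun setT phi^`()%classic.
  by apply: measurable_smooth; apply: derive1_smooth; case: tphi.
rewrite (_ : EFin \o _ = (EFin \o u) \* (EFin \o phi^`()%classic))%E; last first.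
  by apply/funext => x /=; rewrite EFinM.
apply: integrableMl => //.
- exact: measurable_funS mphi'.
- exact: (@bounded_on _ _ _ _ M).
Qed.

(** The difference of [u] and of the primitive of [g'] has zero weak
    derivative, hence is constant. *)
Lemma weak_derivative_representation a b x0 u g g' : a < b -> x0 <= a ->
  mu.-integrable `]a, b[ (EFin \o u) -> is_weak_derivative a b u g ->
  locally_bounded_measurable g' ->
  {ae mu, forall x, a < x < b -> g x = g' x} ->
  exists c, {ae mu, forall x, a < x < b -> u x = c + primitive x0 g' x}.
Proof.
move=> ab x0a iu [lu lg w] lg' gg'.
have [lp _ w'] := weak_derivative_primitive 0 b lg' x0a.
have ip : mu.-integrable `]a, b[ (EFin \o (fun x => 0 + primitive x0 g' x)).
  by apply: lbm_integrable; exact: lbm_primitive.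
have [|phi tphi|k hk] := @du_bois_reymond R a b (u \- (fun x => 0 + primitive x0 g' x)) ab.
- exact: locally_integrableB.
- under eq_Rintegral do rewrite /= mulrBl.
  rewrite RintegralB//; [|exact: integrableM_test_derive|exact: integrableM_test_derive].
  rewrite w// w'//; apply/eqP; rewrite subr_eq0 eqr_opp; apply/eqP.
  have mphi : measurable_fun setT phi.
    by apply: measurable_smooth; case: tphi.
  apply: ae_eq_Rintegral => //.
  + by apply: measurable_funM; [by case: lg|exact: measurable_funS mphi].
  + apply: measurable_funM; last exact: measurable_funS mphi.
    by case: lg' => mg' _; exact: measurable_funS mg'.
  move: gg'; apply: ae_mono.
  by move=> x H; rewrite /= in_itv/= => /H ->.
exists k; move: hk; apply: ae_mono.
by move=> x H /H /=; rewrite add0r => <-; rewrite subrK.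
Qed.

Lemma Linfty_ae_bounded (D : set R) f : measurable D -> L_space mu +oo%E D f ->
  measurable_fun D f /\ exists2 M, 0 <= M & {ae mu, forall x, D x -> `|f x| <= M}.
Proof.
move=> mD; rewrite /L_space inE => /andP[/=]; rewrite !inE/= => mf.
rewrite /finite_norm unlock /= ifT; last first.
  apply: (@lt_le_trans _ _ (mu `]0, 1[)).
    by rewrite lebesgue_measure_itv/= lte_fin ltr01 oppr0 adde0 lte_fin ltr01.
  by apply: le_measure => //; rewrite inE//; exact: measurable_itv.
move=> fy; split; first by apply/(measurable_restrictT _ _).2.
have [M M0 eM] : exists2 M, 0 <= M & (ess_sup mu (abse \o (EFin \o f \_ D)) <= M%:E)%E.
  move: fy; case: ess_sup => [r _|//|_]; last by exists 0; rewrite ?leNye.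
  by exists (Num.max r 0); rewrite ?lee_fin le_max lexx ?orbT.
exists M => //; move/ess_supP : eM; apply: ae_mono => x /= + Dx.
by rewrite patchE mem_set// lee_fin.
Qed.

Lemma bounded_Linfty (D : set R) f M : measurable D -> measurable_fun D f ->
  (forall x, D x -> `|f x| <= M) -> L_space mu +oo%E D f.
Proof.
move=> mD mf fM; rewrite /L_space inE; apply/andP; rewrite !inE/=; split.
  exact/(measurable_restrictT _ _).1.
rewrite /finite_norm unlock /=; case: ifP => // _.
apply: (@le_lt_trans _ _ (Num.max M 0)%:E); last exact: ltry.
apply/ess_supP; apply: aeW => x /=; rewrite patchE lee_fin le_max.
case: ifPn => [|_]; last by rewrite normr0 lexx orbT.
by rewrite inE => /fM ->.
Qed.
End Representation.
(** * Dominated convergence in L2 *)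

Section L2.
Context {d : measure_display} {T : measurableType d} {R : realType}.
Context (m : {measure set T -> \bar R}).
Implicit Types (D : set T) (f : T -> R) (M : R).

Lemma L_norm2E D f : (L_norm m 2%:E D f `^ 2 = \int[m]_(x in D) (f x ^+ 2)%:E)%E.
Proof.
rewrite /L_norm powR_Lnorm// [RHS]integral_mkcond; apply: eq_integral => x _.
rewrite /= !patchE; case: ifPn => _.
  by rewrite powR_mulrn// real_normK// num_real.
by rewrite normr0 powR0.
Qed.

Lemma bounded_L2 D f M : measurable D -> (m D < +oo)%E -> measurable_fun D f ->
  {ae m, forall x, D x -> `|f x| <= M} -> L_space m 2%:E D f.
Proof.
move=> mD Doo mf fM; rewrite /L_space inE; apply/andP; rewrite !inE/=; split.
  exact/(measurable_restrictT _ _).1.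
rewrite /finite_norm.
have : ((L_norm m 2%:E D f) `^ 2 < +oo)%E.
  rewrite L_norm2E.
  apply: (@le_lt_trans _ _ (\int[m]_(x in D) (M ^+ 2)%:E)%E); last first.
    rewrite integral_cst//; apply: lte_mul_pinfty => //.
    by rewrite lee_fin sqr_ge0.
  apply: ae_ge0_le_integral => //.
  - by move=> x _; rewrite lee_fin sqr_ge0.
  - apply/measurable_EFinP; exact: measurable_funX.
  - by move=> x _; rewrite lee_fin sqr_ge0.
  - move: fM; apply: ae_mono => x H /H h; rewrite lee_fin -real_normK ?num_real//.
    by rewrite lerXn2r ?nnegrE// (le_trans _ h).
exact: lty_poweRy.
Qed.

Lemma L_normE D f :
  L_norm m 2%:E D f = ((\int[m]_(x in D) (f x ^+ 2)%:E) `^ 2^-1)%E.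
Proof.
rewrite -L_norm2E -poweRrM mulfV// poweRe1//; exact: Lnorm_ge0.
Qed.

Lemma L_norm_ae_eq D f g : measurable D -> measurable_fun D f -> measurable_fun D g ->
  {ae m, forall x, D x -> f x = g x} -> L_norm m 2%:E D f = L_norm m 2%:E D g.
Proof.
move=> mD mf mg fg; rewrite !L_normE; congr (_ `^ _)%E.
apply: ae_eq_integral => //.
- by apply/measurable_EFinP; exact: measurable_funX.
- by apply/measurable_EFinP; exact: measurable_funX.
- by move: fg; apply: ae_mono => x H /H ->.
Qed.

Lemma L2_cvg0 D (u : nat -> T -> R) M : measurable D -> (m D < +oo)%E ->
  (forall n, measurable_fun D (u n)) ->
  (forall n, {ae m, forall x, D x -> `|u n x| <= M}) ->
  {ae m, forall x, D x -> u n x @[n --> \oo] --> (0 : R)} ->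
  (\int[m]_(x in D) (u n x ^+ 2)%:E @[n --> \oo] --> 0)%E.
Proof.
move=> mD Doo mu_ uM u0.
have [] := @dominated_convergence _ _ _ m D mD (fun n x => (u n x ^+ 2)%:E) (cst 0%E) (cst (M ^+ 2)%:E).
- by move=> n; apply/measurable_EFinP; exact: measurable_funX.
- exact: measurable_cst.
- move: u0; apply: ae_mono => x H /H h; apply: cvg_EFin; first exact: nearW.
  by rewrite -[X in _ --> X](expr0n R 2); exact: (cvg_comp _ _ h (@exprn_continuous _ 2 0)).
- apply: measurable_bounded_integrable => //.
  exact: (@bounded_on _ _ _ _ `|M ^+ 2|).
- have : {ae m, forall x n, D x -> `|u n x| <= M} by exact: ae_foralln.
  apply: ae_mono => x H n /(H n) h; rewrite lee_fin ger0_norm ?sqr_ge0//.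
  by rewrite -real_normK ?num_real// lerXn2r ?nnegrE// (le_trans _ h).
by move=> _ _; rewrite integral0.
Qed.

(** The filter is not a sequence; a decreasing countable base turns a failure
    of convergence into a sequence to which dominated convergence applies. *)
Lemma L_norm_cvg0 {I : Type} (F : set_system I) (FF : Filter F) (B : nat -> set I)
    D (u : I -> T -> R) M :
  (forall n, F (B n)) -> (forall P, F P -> exists n, B n `<=` P) ->
  (forall n k, (n <= k)%N -> B k `<=` B n) ->
  measurable D -> (m D < +oo)%E ->
  (\forall q \near F, measurable_fun D (u q)) ->
  (\forall q \near F, {ae m, forall x, D x -> `|u q x| <= M}) ->
  {ae m, forall x, D x -> u q x @[q --> F] --> (0 : R)} ->
  forall e : R, 0 < e -> \forall q \near F, (L_norm m 2%:E D (u q) <= e%:E)%E.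
Proof.
move=> FB BF Bd mD Doo mu_ uM u0 e e0.
(* From index [n0] on, the base only contains good parameters. *)
have [n0 Bn0] := BF _ (filterI mu_ uM).
apply: contrapT => nF.
have ex n : exists q, B (n + n0)%N q /\ ~ (L_norm m 2%:E D (u q) <= e%:E)%E.
  apply: contrapT => nex; apply: nF; apply: filterS (FB (n + n0)%N) => q Bq.
  by apply: contrapT => nle; apply: nex; exists q.
have [q qP] := choice ex.
have qF : q n @[n --> \oo] --> F.
  move=> P /BF[k Bk]; exists k => // n /= kn; apply: Bk; apply: Bd (qP n).1.
  by rewrite (leq_trans kn)// leq_addr.
have qgood n : measurable_fun D (u (q n)) /\ {ae m, forall x, D x -> `|u (q n) x| <= M}.
  by apply: Bn0; apply: Bd (qP n).1; rewrite leq_addl.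
have := @L2_cvg0 D (u \o q) M mD Doo (fun n => (qgood n).1) (fun n => (qgood n).2).
move=> /(_ _) S0.
have {}S0 : (\int[m]_(x in D) ((u \o q) n x ^+ 2)%:E @[n --> \oo] --> 0)%E.
  by apply: S0; move: u0; apply: ae_mono => x H /H h; exact: cvg_comp h.
have e2 : (0 < (e ^+ 2)%:E)%E by rewrite lte_fin exprn_gt0.
have [k _ /(_ k (leqnn _))/= Sk] : \forall n \near \oo,
    (\int[m]_(x in D) ((u \o q) n x ^+ 2)%:E < (e ^+ 2)%:E)%E.
  apply: (S0 [set x | (x < (e ^+ 2)%:E)%E]); apply: open_nbhs_nbhs; split => //.
  exact: open_ereal_lt_ereal.
apply: (qP k).2; rewrite L_normE.
have -> : e%:E = ((e ^+ 2)%:E `^ 2^-1)%E.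
  by rewrite poweR_EFin -powR_mulrn ?ltW// -powRrM mulfV// powRr1// ltW.
apply: gt0_ler_poweR; [by rewrite invr_ge0|..|exact: ltW].
- rewrite in_itv/= leey andbT; apply: integral_ge0 => x _.
  by rewrite lee_fin sqr_ge0.
- by rewrite in_itv/= leey andbT ltW.
Qed.
End L2.
(** * Null sets and the limit of small parameters *)

Section NullSets.
Context {R : realType}.
Notation mu := (@lebesgue_measure R).

Lemma lebesgue_measure_unique_scale (s : {nonneg R})
    (nu : {measure set (measurableTypeR R) -> \bar R}) :
  (forall X, ocitv X -> mu X = s%:num%:E * nu X)%E ->
  forall A, measurable A -> mu A = (s%:num%:E * nu A)%E.
Proof. by move=> H A mA; exact: (@lebesgue_measure_unique _ (mscale s nu)). Qed.

(** Up to the factor [s], the image of Lebesgue measure under an affine map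
    has the right value on half-open intervals. *)
Lemma lebesgue_measure_affine (s t : R) (A : set R) : 0 < s -> measurable A ->
  (s%:E * mu ((fun y : R => (t + s * y)%R) @^-1` A) = mu A)%E.
Proof.
move=> s0 mA.
pose f : measurableTypeR R -> measurableTypeR R := fun y : R => t + s * y.
have mf : measurable_fun setT f.
  by apply: measurable_funD; [exact: measurable_cst|exact: measurable_funM].
pose nu : {measure set (measurableTypeR R) -> \bar R} :=
  measure_function_pushforward__canonical__measure_function_Measure mu mf.
suff H X : ocitv X -> mu X = (s%:E * nu X)%E.
  exact/esym/(@lebesgue_measure_unique_scale (NngNum (ltW s0)) nu).
move=> [[a b] _ <-]; rewrite -[nu _]/(mu (f @^-1` _)) /=.
have -> : f @^-1` `]a, b] = `](a - t) / s, (b - t) / s]%classic.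
  apply/seteqP; split => y; rewrite /f/= !in_itv/= ltr_pdivrMr// ler_pdivlMr// ltrBlDl lerBrDl [y * s]mulrC//.
rewrite !lebesgue_measure_itv/= !lte_fin ltr_pM2r ?invr_gt0// ltrD2r.
case: ifP => _; last by rewrite mule0.
by rewrite -EFinM; congr (_%:E); field; rewrite gt_eqF.
Qed.

Lemma null_affine (s t : R) (N : set R) : 0 < s -> measurable N -> mu N = 0 ->
  mu ((fun y : R => (t + s * y)%R) @^-1` N) = 0.
Proof.
move=> s0 mN; rewrite -(lebesgue_measure_affine t s0 mN) => /eqP.
by rewrite mule_eq0 eqe gt_eqF//= => /eqP.
Qed.

(** For fixed [z.1], the section is an affine preimage of a null set, so the
    cell function [c] is arbitrary. *)
Lemma null_unfold (c : R * R -> R) (s : R) (N : set R) : 0 < s ->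
  measurable N -> mu N = 0 ->
  lebesgue_R2R2 (R := R) [set z | N (c z.1 + s * z.2.1)] = 0.
Proof.
move=> s0 mN N0; rewrite /lebesgue_R2R2 /prod_measure /product_measure1/=.
apply: integral0_eq => x _ /=.
rewrite (_ : xsection _ _ = ((fun y : R => c x + s * y) @^-1` N) `*` setT); last first.
  apply/seteqP; split => -[y1 y2]; rewrite /xsection/=.
    by rewrite inE/=; split.
  by move=> [? _]; rewrite inE.
rewrite /lebesgue_R2 /prod_measure product_measure1E//.
  rewrite [X in (X * _)%E](_ : _ = 0%E) ?mul0e//; exact: null_affine.
have mf : measurable_fun setT (fun y : R => c x + s * y).
  by apply: measurable_funD; [exact: measurable_cst|exact: measurable_funM].
by have := mf measurableT N mN; rewrite setTI.
Qed.

Lemma null_fst (N : set R) : measurable N -> mu N = 0 ->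
  lebesgue_R2R2 (R := R) [set z | N z.1.1] = 0.
Proof.
move=> mN N0.
rewrite (_ : [set _ | _] = (N `*` setT) `*` setT); last first.
  by apply/seteqP; split => -[[x1 x2] y] /=; [move=> Nx; do 2 split|case=> -[]].
rewrite /lebesgue_R2R2 /prod_measure product_measure1E//; last exact: measurableX.
rewrite [X in (X * _)%E](_ : _ = 0%E) ?mul0e//.
transitivity (mu N * mu setT)%E; first exact: product_measure1E.
by rewrite N0 mul0e.
Qed.

Lemma ae_unfold (c : R * R -> R) (s : R) (P : R -> Prop) : 0 < s ->
  measurable_fun setT c -> {ae mu, forall x, P x} ->
  {ae lebesgue_R2R2 (R := R), forall z, P (c z.1 + s * z.2.1)}.
Proof.
move=> s0 mc [N [mN N0 sN]].
exists [set z | N (c z.1 + s * z.2.1)]; split.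
- have mf : measurable_fun setT (fun z : (R * R) * (R * R) => c z.1 + s * z.2.1).
    apply: measurable_funD; first by apply: (measurableT_comp mc); exact: measurable_fst.
    apply: measurable_funM => //.
    by apply: (measurableT_comp measurable_fst); exact: measurable_snd.
  by have := mf measurableT N mN; rewrite setTI.
- exact: (null_unfold c s0 mN N0).
- by move=> z nP; apply: sN.
Qed.

Lemma ae_fst (P : R -> Prop) : {ae mu, forall x, P x} ->
  {ae lebesgue_R2R2 (R := R), forall z, P z.1.1}.
Proof.
move=> [N [mN N0 sN]]; exists [set z | N z.1.1]; split.
- have mf : measurable_fun setT (fun z : (R * R) * (R * R) => z.1.1).
    by apply: (measurableT_comp measurable_fst); exact: measurable_fst.
  by have := mf measurableT N mN; rewrite setTI.
- exact: null_fst.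
- by move=> z nP; apply: sN.
Qed.

Definition base_to_zero (L l : R) (n : nat) : set (R * R) :=
  [set q : R * R | [/\ admissible L l q.1 q.2,
       q.1 < n.+1%:R^-1, q.2 < n.+1%:R^-1 & q.2 / q.1 < n.+1%:R^-1]].

Lemma base_to_zeroP (L l : R) n : to_zero L l (base_to_zero L l n).
Proof. by exists n.+1%:R^-1 => //=; rewrite invr_gt0. Qed.

(** Together with [base_to_zeroP] and [base_to_zero_decreasing]: the limit of
    small parameters has a decreasing countable base. *)
Lemma base_to_zero_sub (L l : R) P : to_zero L l P ->
  exists n, base_to_zero L l n `<=` P.
Proof.
move=> [eta /= eta0 sP]; exists (Num.truncn eta^-1).
move=> q [adm q1 q2 q3]; apply: sP.
have h : (Num.truncn eta^-1).+1%:R^-1 <= eta.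
  rewrite -[X in _ <= X]invrK lef_pV2 ?posrE ?invr_gt0//.
  by apply/ltW; exact: truncnS_gt.
by split => //; [exact: lt_le_trans q1 h|exact: lt_le_trans q2 h|exact: lt_le_trans q3 h].
Qed.

Lemma base_to_zero_decreasing (L l : R) n k : (n <= k)%N ->
  base_to_zero L l k `<=` base_to_zero L l n.
Proof.
move=> nk q [adm q1 q2 q3].
have h : k.+1%:R^-1 <= n.+1%:R^-1 :> R by rewrite lef_pV2 ?posrE// ler_nat.
by split => //; [exact: lt_le_trans q1 h|exact: lt_le_trans q2 h|exact: lt_le_trans q3 h].
Qed.

Lemma cvg0_ereal {I : Type} (F : set_system I) (FF : Filter F) (f : I -> \bar R) :
  (forall q, 0 <= f q)%E ->
  (forall e : R, 0 < e -> \forall q \near F, (f q <= e%:E)%E) ->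
  f q @[q --> F] --> 0%E.
Proof.
move=> f0 fe A [r /= r0 rA].
apply: filterS (fe (r / 2) _); last by rewrite divr_gt0.
move=> q /= fq; have : f q \is a fin_num.
  by rewrite ge0_fin_numE// (le_lt_trans fq) ?ltry.
move=> /fineK e; rewrite /= -e; apply: rA.
rewrite /= sub0r normrN ger0_norm ?fine_ge0//.
by rewrite (@le_lt_trans _ _ (r / 2))// -?lee_fin ?e// ltr_pdivrMr// ltr_pMr// ltr1n.
Qed.
End NullSets.
(** * Concentrating a slope on thin strips *)

Section Construction.
Context {R : realType}.
Implicit Types (t x y : R) (p : int) (n : nat).
Notation mu := (@lebesgue_measure R).

Lemma measurable_cell (eps : R) (f : R -> R) : measurable_fun setT f ->
  measurable_fun setT (fun t => eps * (Num.floor (f t))%:~R).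
Proof.
move=> mf; apply: measurable_funM => //.
apply: (@measurableT_comp _ _ _ _ _ _ (fun x : R => (Num.floor x)%:~R : R)) => //.
apply: nondecreasing_measurable => // x y xy.
by rewrite ler_int le_floor.
Qed.

(** [p] is the node nearest to [t], and the jump is that of [G] over the cell
    to the left of [p]. *)
Definition concentrated (G : R -> R) (eps del t : R) : R :=
  let p := eps * (Num.floor (t / eps + 2^-1))%:~R in
  if `|t - p| < del / 2 then (G p - G (p - eps)) / del else 0.

Context (G : R -> R) (eps del M : R).
Context (M0 : 0 <= M) (lipG : forall x y, `|G y - G x| <= M * `|y - x|).
Context (cG : continuous G).
Context (del0 : 0 < del) (deleps : 3 * del < eps).
Local Notation g := (concentrated G eps del).

Let eps0 : 0 < eps. Proof. by move: del0 deleps; lra. Qed.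

Lemma concentrated_on p t : `|t - eps * p%:~R| < del / 2 ->
  g t = (G (eps * p%:~R) - G (eps * p%:~R - eps)) / del.
Proof.
move=> tp; rewrite /concentrated (_ : Num.floor _ = p) ?tp//.
apply: floor_def; move: tp; rewrite ltr_norml => /andP[h1 h2].
have e0 := eps0; have h3 := deleps; have h4 := del0.
have -> : t / eps + 2^-1 = (t + eps / 2) / eps by field; rewrite gt_eqF.
rewrite ler_pdivlMr// ltr_pdivrMr// rmorphD/=; apply/andP; split; nra.
Qed.

Lemma concentrated_off t : (forall p, del / 2 <= `|t - eps * p%:~R|) -> g t = 0.
Proof. by move=> H; rewrite /concentrated ltNge H. Qed.

Lemma concentrated_bound t : `|g t| <= M * eps / del.
Proof.
have e0 := eps0.
rewrite /concentrated; case: ifP => _; last first.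
  by rewrite normr0 divr_ge0 ?(ltW del0)// mulr_ge0// ltW.
rewrite normrM normfV (gtr0_norm del0) ler_pM2r ?invr_gt0//.
by rewrite (le_trans (lipG _ _))// opprB addrC subrK gtr0_norm.
Qed.

Lemma measurable_concentrated : measurable_fun setT g.
Proof.
have mp : measurable_fun setT (fun t => eps * (Num.floor (t / eps + 2^-1))%:~R).
  by apply: measurable_cell; apply: measurable_funD => //; exact: measurable_funM.
have mG : measurable_fun setT G by exact: continuous_measurable_fun.
apply: measurable_fun_ifT.
- apply: measurable_fun_ltr => //; apply: measurableT_comp => //.
  by apply: measurable_funB.
- apply: measurable_funM => //; apply: measurable_funB.
    exact: (measurableT_comp mG).
  by apply: (measurableT_comp mG); apply: measurable_funB.
- exact: measurable_cst.
Qed.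

Lemma lbm_concentrated : locally_bounded_measurable g.
Proof.
split; first exact: measurable_concentrated.
by move=> B; exists (M * eps / del) => x _; exact: concentrated_bound.
Qed.

Let s n : R := (n%:R - 2^-1) * eps.

(** [s n] and [s n.+1] are the midpoints of the cells around the node
    [n eps]: between them lies exactly one strip. *)
Lemma integral_concentrated n x : s n <= x -> x <= s n.+1 ->
  \int[mu]_(t in `]s n, x]) g t =
  (G (eps * n%:R) - G (eps * n%:R - eps)) / del *
  fine (mu (`]s n, x] `&` `]eps * n%:R - del / 2, eps * n%:R + del / 2[)).
Proof.
move=> snx xsn; pose k := (G (eps * n%:R) - G (eps * n%:R - eps)) / del.
pose P : set R := `]eps * n%:R - del / 2, eps * n%:R + del / 2[%classic.
rewrite -/k -/P -Rintegral_cst; last by apply: measurableI; exact: measurable_itv.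
rewrite Rintegral_mkcondr; apply: eq_Rintegral => t.
rewrite inE/= in_itv/= => /andP[snt tx]; rewrite patchE.
have [tP|] := boolP (t \in P).
  rewrite (@concentrated_on n%:Z)//; move/set_mem: tP; rewrite /P /= in_itv/= => /andP[h1 h2].
  by rewrite pmulrn ltr_distlC; apply/andP; split; lra.
rewrite /P notin_setE/= in_itv/= => /negP tP.
transitivity (0 : R); last by []; apply: concentrated_off => p.
have e0 := eps0; have h3 := deleps; have h4 := del0.
have {}xsn : t <= s n.+1 by exact: le_trans xsn.
move: snt xsn; rewrite /s -[n.+1%:R]natr1 => snt xsn.
have [pn|np|pn] := ltgtP p n%:Z.
- have : (p%:~R : R) + 1 <= n%:R.
    by rewrite -[1]/(1%:~R) -rmorphD pmulrn ler_int lezD1.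
  by move=> h; rewrite ler_normr; apply/orP; left; nra.
- have : (n%:R : R) + 1 <= p%:~R.
    by rewrite -[1]/(1%:~R) pmulrn -rmorphD ler_int lezD1.
  by move=> h; rewrite ler_normr; apply/orP; right; nra.
- rewrite pn leNgt -pmulrn; apply: contra tP; rewrite ltr_distlC => /andP[h1 h2].
  by apply/andP; split; lra.
Qed.

(** The initial value [G (- eps)] and the base point [- eps / 2], to the left
    of the strip at [0], are those for which [slope_node] holds from [n = 0]. *)
Definition slope x := G (- eps) + primitive (- (eps / 2)) g x.

Lemma slope_node n : slope (s n) = G (eps * n%:R - eps).
Proof.
have e0 := eps0; have h3 := deleps; have h4 := del0.
elim: n => [|n IH].
  rewrite /slope primitive_le ?addr0 ?mulr0 ?add0r//.
  by rewrite /s sub0r mulNr mulrC.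
have sn : s n <= s n.+1 by rewrite /s -[n.+1%:R]natr1; nra.
have s0n : - (eps / 2) <= s n by rewrite /s; have : 0 <= n%:R :> R by []; nra.
have -> : slope (s n.+1) = slope (s n) + \int[mu]_(t in `]s n, s n.+1]) g t.
  rewrite -(primitiveB lbm_concentrated s0n sn) /slope; ring.
rewrite IH integral_concentrated// setIidr; last first.
  apply: subset_itv; rewrite bnd_simp /s -?[n.+1%:R]natr1; lra.
rewrite lebesgue_measure_itv/= lte_fin ifT; last lra.
have -> : eps * n.+1%:R - eps = eps * n%:R by rewrite -[n.+1%:R]natr1; ring.
rewrite -EFinB/=.
by field; rewrite gt_eqF.
Qed.

(** On the block around the node [n eps], the slope starts at
    [G (n eps - eps)] and moves by at most one increment of [G]; the point [x]
    itself is within [2 eps] of [n eps - eps]. *)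
Lemma slope_close x : (forall y, y <= 0 -> G y = G 0) ->
  `|slope x - G x| <= 3 * M * eps.
Proof.
have e0 := eps0; have h3 := deleps; have h4 := del0.
move=> G0; have [xe|xe] := leP x (- (eps / 2)).
  rewrite /slope primitive_le// addr0 !G0 ?subrr ?normr0; try lra.
  by apply: mulr_ge0; [exact: mulr_ge0|exact: ltW].
pose n := Num.truncn (x / eps + 2^-1).
have : n%:R <= x / eps + 2^-1 < n.+1%:R.
  apply: truncn_itv; rewrite -(pmulr_lge0 _ e0) mulrDl divfK ?gt_eqF//; lra.
rewrite -lerBlDr -ltrBrDr ler_pdivlMr// ltr_pdivrMr// -!/(s _) => /andP[snx xsn].
have s0n : - (eps / 2) <= s n by rewrite /s; have : 0 <= n%:R :> R by []; nra.
have -> : slope x - G x = (G (eps * n%:R - eps) - G x) + \int[mu]_(t in `]s n, x]) g t.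
  rewrite -(primitiveB lbm_concentrated s0n snx) -slope_node /slope; ring.
rewrite (le_trans (ler_normD _ _))//.
have b1 : `|G (eps * n%:R - eps) - G x| <= M * (2 * eps).
  rewrite (le_trans (lipG _ _))// ler_wpM2l// ler_norml.
  by move: snx xsn; rewrite /s -[n.+1%:R]natr1 => ? ?; apply/andP; split; lra.
have b2 : `|\int[mu]_(t in `]s n, x]) g t| <= M * eps.
  rewrite integral_concentrated// ?(ltW xsn)// normrM.
  set I := (X in mu X).
  have mI : (mu I <= del%:E)%E.
    have <- : mu `]eps * n%:R - del / 2, eps * n%:R + del / 2[ = del%:E.
      rewrite lebesgue_measure_itv/= lte_fin ifT; last lra.
      by rewrite -EFinB; congr (_%:E); field.
    apply: le_measure; rewrite ?inE//; last exact: subIsetr.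
    by apply: measurableI; exact: measurable_itv.
  have fI : mu I \is a fin_num by rewrite ge0_fin_numE// (le_lt_trans mI)// ltry.
  have h : `|fine (mu I)| <= del.
    by rewrite ger0_norm ?fine_ge0// -lee_fin fineK.
  have -> : M * eps = M * eps / del * del by field; rewrite gt_eqF.
  apply: ler_pM => //; rewrite normrM normfV (gtr0_norm del0).
  rewrite ler_pM2r ?invr_gt0// (le_trans (lipG _ _))// ler_wpM2l//.
  by rewrite opprB addrC subrK gtr0_norm.
by rewrite (_ : 3 * M * eps = M * (2 * eps) + M * eps); [exact: lerD|ring].
Qed.

(** As [|del y| < del / 2], the argument lies in the strip of its cell. *)
Lemma concentrated_unfold2 x y : `|y| < 2^-1 ->
  del / eps * g (cell eps x + del * y) = (G (cell eps x) - G (cell eps x - eps)) / eps.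
Proof.
move=> y2; have e0 := eps0; rewrite /cell (@concentrated_on (Num.floor (x / eps))).
  by field; rewrite !gt_eqF.
by rewrite addrC addKr normrM gtr0_norm// ltr_pM2l.
Qed.

(** The argument is at distance at least [del] from the nodes at both ends of
    its cell. *)
Lemma concentrated_unfold1 x y : 0 < y -> y < 1 ->
  del / eps < y -> del / eps < 1 - y -> g (cell eps x + eps * y) = 0.
Proof.
move=> y0 y1; have e0 := eps0; have h3 := deleps; have h4 := del0.
rewrite !ltr_pdivrMr// => hy h1y; apply: concentrated_off => p; rewrite /cell.
set k := Num.floor _; have [pk|kp] := leP p k.
- have h : (p%:~R : R) <= k%:~R by rewrite ler_int.
  by rewrite ler_normr; apply/orP; left; nra.
- have h : (k%:~R : R) + 1 <= p%:~R.
    by rewrite -[1]/(1%:~R) -rmorphD ler_int lezD1.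
  by rewrite ler_normr; apply/orP; right; nra.
Qed.

(** The node nearest to [t] is at most [k eps], so both values of [G] in its
    jump are zero; this covers the left half of the strip around [k eps]. *)
Lemma concentrated_eq0 (k : int) t : (forall y, y <= eps * k%:~R -> G y = 0) ->
  t <= eps * k%:~R -> g t = 0.
Proof.
move=> G0 tk; rewrite /concentrated; set p := Num.floor _.
case: ifP => //; rewrite ltr_distlC => /andP[_ h].
have e0 := eps0; have h3 := deleps; have h4 := del0.
have pk : (p%:~R : R) <= k%:~R.
  rewrite ler_int -ltzD1 -(ltr_int R) rmorphD/=.
  rewrite -(ltr_pM2l e0) mulrDr mulr1; lra.
have {}pk : eps * p%:~R <= eps * k%:~R by rewrite ler_pM2l.
by rewrite !G0 ?subrr ?mul0r// (le_trans _ pk)// gerBl ltW.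
Qed.

Lemma slope_eq0 (k : int) x : 0 <= eps * k%:~R ->
  (forall y, y <= eps * k%:~R -> G y = 0) -> x <= eps * k%:~R -> slope x = 0.
Proof.
move=> k0 G0 xk; have e0 := eps0.
rewrite /slope G0 ?add0r; last by rewrite (le_trans _ k0)// oppr_le0 ltW.
rewrite /primitive (@eq_Rintegral _ _ _ _ _ (cst 0)).
  by rewrite Rintegral_cst ?mul0r.
move=> t; rewrite inE/= in_itv/= => /andP[_ tx].
by apply: (concentrated_eq0 G0); rewrite (le_trans tx).
Qed.

Lemma lbm_slope : locally_bounded_measurable slope.
Proof. by apply: lbm_primitive; exact: lbm_concentrated. Qed.

End Construction.

(** * Difference quotients over the cells *)

Section DifferenceQuotient.
Context {R : realType}.

Lemma derivable_expansion (G : R -> R) (x : R) : derivable G x 1 ->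
  forall e, 0 < e -> exists2 r, 0 < r &
  forall y, `|y - x| < r -> `|G y - G x - (y - x) * G^`()%classic x| <= e * `|y - x|.
Proof.
move=> dG e e0; move: (dG); rewrite /derivable => /cvgrPdist_le /(_ e e0) [r /= r0 H].
exists r => // y yx; have [->|yx0] := eqVneq y x.
  by rewrite !subrr mul0r subrr !normr0 mulr0.
have yx1 : y - x != 0 by rewrite subr_eq0.
have := H (y - x); rewrite /= sub0r normrN => /(_ yx yx1).
rewrite -[lim _]/('D_1 G x) -derive1E /GRing.scale/= mulr1 subrK distrC => h.
rewrite -ler_pdivrMr ?normr_gt0// -normfV -normrM.
apply: le_trans h; rewrite le_eqVlt; apply/orP; left; apply/eqP; congr (`|_|).
by field.
Qed.

(** Both endpoints of the quotient lie within [2 eps] of [x], on the same side;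
    the linear expansion at [x] has errors at most [e eps / 3] and
    [2 e eps / 3]. *)
Lemma difference_quotient_cvg (G : R -> R) (x L l : R) : derivable G x 1 ->
  (G (cell q.1 x) - G (cell q.1 x - q.1)) / q.1 @[q --> to_zero L l] --> G^`()%classic x.
Proof.
move=> dG; apply/cvgrPdist_le => e e0.
have e3 : 0 < e / 3 by rewrite divr_gt0.
have [r r0 H] := derivable_expansion dG e3.
exists (r / 2); first by rewrite /= divr_gt0.
move=> [eps del] /= [[d0 de _ _ _] epsr _ _].
have eps0 : 0 < eps by lra.
have /andP[c1 c2] : cell eps x <= x < cell eps x + eps.
  have /andP[h1 h2] := floor_itv (x / eps).
  rewrite /cell; apply/andP; split; first by rewrite mulrC -ler_pdivlMr.
  by rewrite -[X in _ + X]mulr1 -mulrDr mulrC -ltr_pdivrMr//; move: h2; rewrite rmorphD.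
have h1 := H (cell eps x) _; have h2 := H (cell eps x - eps) _.
have {}h1 : `|G (cell eps x) - G x - (cell eps x - x) * G^`()%classic x| <= e / 3 * eps.
  rewrite (le_trans (h1 _))//.
    by rewrite ltr_norml; apply/andP; split; lra.
  by rewrite ler_pM2l// ler_norml; apply/andP; split; lra.
have {}h2 : `|G (cell eps x - eps) - G x - (cell eps x - eps - x) * G^`()%classic x| <= e / 3 * (2 * eps).
  rewrite (le_trans (h2 _))//.
    by rewrite ltr_norml; apply/andP; split; lra.
  by rewrite ler_pM2l// ler_norml; apply/andP; split; lra.
rewrite distrC -(ler_pM2r eps0) -[X in _ * X <= _](gtr0_norm eps0) -normrM.
rewrite mulrBl divfK ?gt_eqF//.
move: h1 h2; rewrite !ler_norml => /andP[? ?] /andP[? ?].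
by apply/andP; split; lra.
Qed.
End DifferenceQuotient.
(** * Sobolev functions as iterated primitives *)

Section Assembly.
Context {R : realType}.
Notation mu := (@lebesgue_measure R).
Local Notation lbm := locally_bounded_measurable.
Implicit Types (a b c x y t L l eps del M : R).

Lemma integrable_ae_bounded a b (u : R -> R) M : measurable_fun `]a, b[ u ->
  {ae mu, forall x, a < x < b -> `|u x| <= M} -> mu.-integrable `]a, b[ (EFin \o u).
Proof.
move=> mu_ uM; apply/integrableP; split; first exact/measurable_EFinP.
apply: (@le_lt_trans _ _ (\int[mu]_(x in `]a, b[) (`|M|)%:E)%E).
  apply: ae_ge0_le_integral => //.
  - by apply/measurable_EFinP; exact: measurableT_comp.
  - move: uM; apply: ae_mono => x H; rewrite /= in_itv/= => /H h.
    by rewrite lee_fin (le_trans h)// ler_norm.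
rewrite integral_cst//; apply: lte_mul_pinfty => //; exact: itv_finite_measure.
Qed.

Lemma lbm_Linfty a b g : lbm g -> L_space mu +oo%E `]a, b[ g.
Proof.
move=> lg; have [M M0 gM] := lbm_bounded_itv a b lg.
apply: (bounded_Linfty (M := M)) => //; first exact: measurable_funS lg.1.
by move=> x; rewrite /= in_itv/= => /andP[ax xb]; apply: gM; rewrite !ltW.
Qed.

Lemma Linfty_L2 a b g : L_space mu +oo%E `]a, b[ g -> L_space mu 2%:E `]a, b[ g.
Proof.
move=> /Linfty_ae_bounded[//|mg [M _ gM]].
by apply: (bounded_L2 (M := M)) => //; exact: itv_finite_measure.
Qed.

(** The base point [-1] lies to the left of all the intervals
    [(- del / 2, L + del / 2)], since [del < 1]. *)
Lemma sobolev_representation L (Phi : R -> R) : 0 < L -> sobolev 2 +oo%E 0 L Phi ->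
  let D1 := weak_derivative 0 L Phi in
  let D2 := weak_derivative 0 L D1 in
  exists g M c0 c1, let G1 := fun x => c1 + primitive (-1) g x in
  [/\ [/\ measurable_fun setT g, 0 <= M, forall x, `|g x| <= M &
        forall x, ~~ (0 < x < L) -> g x = 0],
     is_weak_derivative 0 L Phi D1, is_weak_derivative 0 L D1 D2,
     [/\ {ae mu, forall x, 0 < x < L -> D2 x = g x},
      {ae mu, forall x, 0 < x < L -> D1 x = G1 x} &
      {ae mu, forall x, 0 < x < L -> Phi x = c0 + primitive (-1) G1 x}] &
      sobolev 1 2%:E 0 L Phi].
Proof.
move=> L0 [HPhi [g1 w1 [Hg1 [g2 w2 [Hg2 _]]]]] D1 D2.
have wD1 : is_weak_derivative 0 L Phi D1 by exact: weak_derivativeP w1.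
have D1g1 : {ae mu, forall x, 0 < x < L -> D1 x = g1 x}.
  by apply: weak_derivative_unique wD1 w1; exact: aeW.
have lD1 : locally_integrable `]0, L[ D1 by case: wD1.
have [wD2 D2g2] := weak_derivative_eq D1g1 lD1 w2.
have [//|mg2 [M M0 g2M]] := Linfty_ae_bounded _ Hg2.
pose h := g2 \_ `]0, L[.
have mh : measurable_fun setT h by apply/(measurable_restrictT _ _).1.
(* Truncation turns the almost everywhere bound on [g2] into a bound that
   holds everywhere. *)
pose g x := if `|h x| <= M then h x else 0.
have mg : measurable_fun setT g.
  by apply: measurable_fun_ifT => //; apply: measurable_fun_ler => //; exact: measurableT_comp.
have gM x : `|g x| <= M by rewrite /g; case: ifP => // _; rewrite normr0.
have g0 x : ~~ (0 < x < L) -> g x = 0.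
  move=> xL; have h0 : h x = 0.
    rewrite /h patchE ifF//.
    by apply/negbTE; rewrite notin_setE/= in_itv/=; exact/negP.
  by rewrite /g h0 if_same.
have gg2 : {ae mu, forall x, 0 < x < L -> g2 x = g x}.
  move: g2M; apply: ae_mono => x H xL.
  have xL' : `]0, L[%classic x by rewrite /= in_itv.
  have hx : h x = g2 x by rewrite /h patchE mem_set.
  by rewrite /g hx H.
have lg : lbm g by split => // B; exists M.
have iD1 : mu.-integrable `]0, L[ (EFin \o D1).
  have [//|_ [M1 _ g1M]] := Linfty_ae_bounded _ Hg1.
  apply: (integrable_ae_bounded (M := M1)); first by case: lD1.
  move: (ae_and D1g1 g1M); apply: ae_mono => x [H1 H2] xL.
  by rewrite H1//; apply: H2; rewrite /= in_itv.
have iPhi : mu.-integrable `]0, L[ (EFin \o Phi).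
  have [//|mPhi [M1 _ PM]] := Linfty_ae_bounded _ HPhi.
  apply: (integrable_ae_bounded (M := M1)); first by [].
  by move: PM; apply: ae_mono => x H xL; apply: H; rewrite /= in_itv.
have N10 : -1 <= 0 :> R by rewrite lerN10.
have [c1 D1G1] := weak_derivative_representation L0 N10 iD1
  (weak_derivative_ae_eq D1g1 lD1 w2) lg gg2.
have lG1 := lbm_primitive c1 (-1) lg.
have [c0 PhiG0] := weak_derivative_representation L0 N10 iPhi wD1 lG1 D1G1.
exists g, M, c0, c1; split => //.
- split => //; move: (ae_and D2g2 gg2); apply: ae_mono => x [H1 H2] xL.
  exact: etrans (H1 xL) (H2 xL).
- split; first exact: Linfty_L2.
  by exists g1 => //; split => //; exact: Linfty_L2.
Qed.

(** A nonzero value, even at an endpoint, would persist on a set of positive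
    measure. *)
Lemma continuous_ae_eq0 a b (f : R -> R) : a < b -> continuous f ->
  {ae mu, forall x, a < x < b -> f x = 0} -> forall x, a <= x <= b -> f x = 0.
Proof.
move=> ab cf [N [mN N0 sN]] x /andP[ax xb]; apply/eqP; apply: contraT => fx0.
have [r /= r0 H] : \forall y \near x, f y != 0.
  exact: (cvgr_neq0 _ (cf x)).
suff : mu `]Num.max a (x - r), Num.min b (x + r)[ = 0.
  rewrite lebesgue_measure_itv/= lte_fin ifT; last first.
    rewrite gt_max !lt_min ab; apply/andP; split; apply/andP; split; lra.
  rewrite -EFinB => -[/eqP]; rewrite subr_eq0 => /eqP e.
  have : Num.max a (x - r) < Num.min b (x + r).
    rewrite gt_max !lt_min ab; apply/andP; split; apply/andP; split; lra.
  by rewrite e ltxx.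
apply: (subset_measure0 _ mN _ N0); first exact: measurable_itv.
move=> y; rewrite /= in_itv/= gt_max lt_min => /andP[/andP[ay xry] /andP[yb yxr]].
apply: sN => /= h; have : f y != 0 by apply: H; rewrite /= ltr_distlC xry.
by rewrite h ?ay// eqxx.
Qed.

Lemma near_to_zero L l (P : R * R -> Prop) :
  (forall q, admissible L l q.1 q.2 -> P q) -> \forall q \near to_zero L l, P q.
Proof. by move=> H; exists 1 => /=; rewrite ?ltr01// => q [/H]. Qed.

Lemma cvg_eps_to_zero L l C (f : R * R -> R) :
  (forall q, admissible L l q.1 q.2 -> `|f q| <= C * q.1) ->
  f q @[q --> to_zero L l] --> (0 : R).
Proof.
move=> H; apply/cvgr0Pnorm_le => e e0.
have C0 : 0 < `|C| + 1 by rewrite ltr_wpDl.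
exists (e / (`|C| + 1)); first by rewrite /= divr_gt0.
move=> q /= [adm qe _ _]; rewrite (le_trans (H _ adm))//.
have q0 : 0 < q.1 by case: adm; lra.
move: qe; rewrite ltr_pdivlMr// => /ltW; apply: le_trans.
by rewrite mulrC ler_pM2l// (le_trans (ler_norm C))// lerDl.
Qed.
End Assembly.

(** * Strong convergence from pointwise convergence *)

Section Transfer.
Context {R : realType} {d : measure_display} {T : measurableType d}.
Context (m : {measure set T -> \bar R}).

(** The exceptional set where [u q] and [w q] differ depends on [q], so
    pointwise convergence makes no sense for [u]: it is required of [w]. *)
Lemma strong_cvg_L2_transfer (L l : R) (D : set T) (u w : R * R -> T -> R)
    (f : T -> R) (M : R) :
  measurable D -> (m D < +oo)%E -> measurable_fun D f ->
  {ae m, forall z, D z -> `|f z| <= M} ->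
  (forall q, admissible L l q.1 q.2 ->
    [/\ measurable_fun D (u q), measurable_fun D (w q),
      {ae m, forall z, D z -> u q z = w q z} &
      {ae m, forall z, D z -> `|w q z| <= M}]) ->
  {ae m, forall z, D z -> w q z @[q --> to_zero L l] --> f z} ->
  strong_cvg_L2 m (to_zero L l) D u f.
Proof.
set F := to_zero L l; move=> mD Doo mf fM H wf; split.
- exact: bounded_L2 fM.
- apply: near_to_zero => q /H[mu_ mw uw wM].
  apply: (bounded_L2 (M := M)) => //.
  have : {ae m, forall z, (D z -> u q z = w q z) /\ (D z -> `|w q z| <= M)}.
    exact: ae_and.
  by apply: ae_mono => z [H1 H2] Dz; rewrite H1// H2.
- apply: cvg0_ereal; first by move=> q; exact: Lnorm_ge0.
  move=> e e0.
  have : \forall q \near F, (L_norm m 2%:E D (w q \- f)%R <= e%:E)%E.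
    apply: (@L_norm_cvg0 _ _ _ _ _ _ _ (base_to_zero L l) D _ (M + M)) => //.
    + exact: base_to_zeroP.
    + exact: base_to_zero_sub.
    + exact: base_to_zero_decreasing.
    + by apply: near_to_zero => q /H[_ mw _ _]; exact: measurable_funB.
    + apply: near_to_zero => q /H[_ _ _ wM].
      have : {ae m, forall z, (D z -> `|f z| <= M) /\ (D z -> `|w q z| <= M)}.
        exact: ae_and.
      apply: ae_mono => z [H1 H2] Dz; rewrite (le_trans (ler_normB _ _))//.
      by rewrite lerD ?H1 ?H2.
    + move: wf; apply: ae_mono => z Hz /Hz h.
      rewrite -(subrr (f z)); apply: cvgB => //; exact: cvg_cst.
  have : \forall q \near F, admissible L l q.1 q.2 by exact: near_to_zero.
  apply: filterS2 => q /H[mu_ mw uw _]; apply: le_trans.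
  rewrite (@L_norm_ae_eq _ _ _ m D (u q \- f) (w q \- f))//.
  + exact: measurable_funB.
  + exact: measurable_funB.
  + by move: uw; apply: ae_mono => z Hz Dz /=; rewrite Hz.
Qed.
End Transfer.
(** * Measurability of unfolded functions *)

Section UnfoldedDensity.
Context {R : realType}.
Notation mu := (@lebesgue_measure R).
Implicit Types (a b x y t L l eps del M : R).

Lemma unfold_ae_eq a b (u v : R -> R) (c : R * R -> R) (s k : R)
    (D : set ((R * R) * (R * R))) :
  measurable_fun `]a, b[ u -> {ae mu, forall x, a < x < b -> u x = v x} ->
  measurable_fun setT c -> 0 < s -> measurable D ->
  (forall z, D z -> a < c z.1 + s * z.2.1 < b) ->
  measurable_fun D (fun z => k * u (c z.1 + s * z.2.1)) /\
  {ae lebesgue_R2R2 (R := R), forall z, D z ->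
    k * u (c z.1 + s * z.2.1) = k * v (c z.1 + s * z.2.1)}.
Proof.
move=> mu_ uv mc s0 mD Dab; split; last first.
  by move: (ae_unfold s0 mc uv); apply: ae_mono => z Hz /Dab /Hz ->.
have mh : measurable_fun setT (fun z : (R * R) * (R * R) => c z.1 + s * z.2.1).
  apply: measurable_funD; first by apply: (measurableT_comp mc); exact: measurable_fst.
  apply: measurable_funM => //.
  by apply: (measurableT_comp measurable_fst); exact: measurable_snd.
apply: measurable_funM => //.
apply: (@measurable_comp _ _ _ _ _ _ `]a, b[%classic u D) => //.
- by move=> _ [z Dz <-] /=; rewrite in_itv/=; exact: Dab.
- exact: measurable_funS mh.
Qed.

(** Since [L] is a multiple of [eps], the cell of a point of [(0, L)] is
    contained in [[0, L]]. *)
Lemma cell_bounds eps L x : 0 < eps -> pos_integer (L / eps) -> 0 < x -> x < L ->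
  0 <= cell eps x /\ cell eps x + eps <= L.
Proof.
move=> e0 [N N0 LN] x0 xL; rewrite /cell; split.
  by apply: mulr_ge0; [exact: ltW|rewrite ler0z floor_ge0 divr_ge0 ?ltW].
have -> : L = eps * N%:R by rewrite -LN mulrCA divff ?mulr1// gt_eqF.
rewrite -[X in _ + X]mulr1 -mulrDr ler_pM2l// pmulrn -[1]/(1%:~R) -rmorphD/= ler_int lezD1.
rewrite -(ltr_int R) -pmulrn -LN (le_lt_trans (floor_le _))//.
by rewrite ltr_pM2r ?invr_gt0.
Qed.

Lemma omegaY_finite L (Y : set (R * R)) (i j : interval R) :
  Y = [set` i] `*` [set` j] -> (mu [set` i] < +oo)%E -> (mu [set` j] < +oo)%E ->
  measurable (omega L `*` Y) /\ (lebesgue_R2R2 (R := R) (omega L `*` Y) < +oo)%E.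
Proof.
move=> -> mi mj.
have mo : measurable (omega L) by apply: measurableX; exact: measurable_itv.
have mY : measurable ([set` i] `*` [set` j] : set (R * R)).
  by apply: measurableX; exact: measurable_itv.
split; first exact: measurableX.
have fin2 (A B : set R) : measurable A -> measurable B -> (mu A < +oo)%E ->
    (mu B < +oo)%E -> (lebesgue_R2 (R := R) (A `*` B) < +oo)%E.
  move=> mA mB fA fB.
  rewrite [X in (X < _)%E](_ : _ = (mu A * mu B)%E); last exact: product_measure1E.
  by apply: lte_mul_pinfty => //; rewrite ge0_fin_numE.
rewrite [X in (X < _)%E](_ : _ = (lebesgue_R2 (R := R) (omega L) *
  lebesgue_R2 (R := R) ([set` i] `*` [set` j]))%E); last exact: product_measure1E.
apply: lte_mul_pinfty; rewrite ?measure_ge0//.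
  rewrite ge0_fin_numE ?measure_ge0//; apply: fin2; try exact: measurable_itv.
    exact: itv_finite_measure.
  exact: itv_finite_measure.
by apply: fin2 => //; exact: measurable_itv.
Qed.
End UnfoldedDensity.

(** * The approximating sequence *)

Section Approximation.
Context {R : realType}.
Notation mu := (@lebesgue_measure R).
Local Notation lbm := locally_bounded_measurable.
Implicit Types (x y t eps del : R).

Context (L l : R) (hl : 0 < l) (hL : l < L) (Phi g : R -> R) (M c0 c1 : R).
Let G1 x := c1 + primitive (-1) g x.
Let G0 x := c0 + primitive (-1) G1 x.
Let D1 := weak_derivative 0 L Phi.
Let D2 := weak_derivative 0 L D1.
Context (mg : measurable_fun setT g) (M0 : 0 <= M) (gM : forall x, `|g x| <= M)
  (g0 : forall x, ~~ (0 < x < L) -> g x = 0).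
Context (wD1 : is_weak_derivative 0 L Phi D1) (wD2 : is_weak_derivative 0 L D1 D2).
Context (D2g : {ae mu, forall x, 0 < x < L -> D2 x = g x})
  (D1G1 : {ae mu, forall x, 0 < x < L -> D1 x = G1 x})
  (PhiG0 : {ae mu, forall x, 0 < x < L -> Phi x = G0 x})
  (sPhi : sobolev 1 2%:E 0 L Phi).

Let lg : lbm g. Proof. by split => // B; exists M. Qed.
Let lG1 : lbm G1. Proof. exact: lbm_primitive. Qed.
Let lG0 : lbm G0. Proof. exact: lbm_primitive. Qed.

Let A2 eps del := concentrated G1 eps del.
Let A1 eps del := slope G1 eps del.
Definition approximation eps del x := c0 + primitive (-1) (A1 eps del) x.
Let A0 := approximation.

(** As [g] vanishes to the left of [0], the increment of [G1] over the cell
    before [0] is zero. *)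
Lemma G1_le0 x : x <= 0 -> G1 x = c1.
Proof.
move=> x0; rewrite /G1 /primitive (@eq_Rintegral _ _ _ _ _ (cst 0)).
  by rewrite Rintegral_cst// mul0r addr0.
move=> t; rewrite inE/= in_itv/= => /andP[_ tx]; apply: g0.
by rewrite negb_and -leNgt (le_trans tx).
Qed.

Lemma G1_lipschitz x y : `|G1 y - G1 x| <= M * `|y - x|.
Proof.
suff H u v : u <= v -> `|G1 v - G1 u| <= M * `|v - u|.
  have [xy|/ltW yx] := leP x y; first exact: H.
  by rewrite distrC [X in _ * X]distrC; exact: H.
move=> uv; have [u1|/ltW u1] := leP (-1) u.
  rewrite (_ : G1 v - G1 u = primitive (-1) g v - primitive (-1) g u); last first.
    by rewrite /G1; ring.
  rewrite primitiveB// (ger0_norm (x := v - u)) ?subr_ge0//.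
  by apply: itv_integral_bound => // t _.
have [v0|/ltW v0] := leP v 0.
  by rewrite !G1_le0 ?subrr ?normr0 ?mulr_ge0//; lra.
rewrite (@G1_le0 u); last lra.
have m1v : -1 <= v by lra.
rewrite (_ : G1 v - c1 = primitive (-1) g v); last by rewrite /G1; ring.
rewrite (le_trans (itv_integral_bound (M := M) _ _ _))//.
by rewrite ler_wpM2l// (ger0_norm (x := v - u)); lra.
Qed.

Lemma G1_continuous : continuous G1.
Proof.
move=> x; apply: cvgD; first exact: cvg_cst.
exact: primitive_continuous.
Qed.

Lemma G0_continuous : continuous G0.
Proof.
move=> x; apply: cvgD; first exact: cvg_cst.
exact: primitive_continuous.
Qed.

Lemma admissible_pos eps del : admissible L l eps del ->
  [/\ 0 < del, 3 * del < eps, 0 < eps, eps < 1 & 0 < del / eps < 3^-1].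
Proof.
move=> [d0 de e1 _ _]; have d0' : 0 < del by lra.
have e0 : 0 < eps by lra.
by split => //; rewrite divr_gt0//= ltr_pdivrMr//; lra.
Qed.

Lemma lbm_approximation_density eps del : admissible L l eps del -> lbm (A2 eps del).
Proof.
move=> /admissible_pos[d0 de e0 _ _].
exact: (lbm_concentrated M0 G1_lipschitz G1_continuous d0 de).
Qed.

Lemma lbm_approximation_slope eps del : admissible L l eps del -> lbm (A1 eps del).
Proof.
move=> /admissible_pos[d0 de e0 _ _].
exact: (lbm_slope M0 G1_lipschitz G1_continuous d0 de).
Qed.

Lemma lbm_approximation eps del : admissible L l eps del -> lbm (A0 eps del).
Proof. by move=> adm; apply: lbm_primitive; exact: lbm_approximation_slope. Qed.

Lemma approximation_slope_close eps del x : admissible L l eps del ->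
  `|A1 eps del x - G1 x| <= 3 * M * eps.
Proof.
move=> /admissible_pos[d0 de e0 _ _].
apply: (slope_close M0 G1_lipschitz G1_continuous d0 de) => y y0.
by rewrite !G1_le0.
Qed.

Lemma approximation_close eps del x : admissible L l eps del -> 0 < x < L ->
  `|A0 eps del x - G0 x| <= 3 * M * eps * (L + 1).
Proof.
move=> adm /andP[x0 xL]; have m1x : -1 <= x by lra.
have lA1 := lbm_approximation_slope adm; have [d0 de e0 _ _] := admissible_pos adm.
rewrite (_ : A0 eps del x - G0 x =
  \int[mu]_(t in `]-1, x]) (A1 eps del t - G1 t)); last first.
  rewrite RintegralB//; [|exact: lbm_integrable|exact: lbm_integrable].
  by rewrite /A0 /approximation /G0 /primitive; ring.
have lD : lbm (fun t => A1 eps del t - G1 t).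
  split; first by apply: measurable_funB; [case: lA1|case: lG1].
  by move=> B; exists (3 * M * eps) => t _; exact: approximation_slope_close.
rewrite (le_trans (itv_integral_bound (M := 3 * M * eps) _ _ _))//.
  by move=> t _; exact: approximation_slope_close.
apply: ler_wpM2l; last lra.
by apply: mulr_ge0; [exact: mulr_ge0|exact: ltW].
Qed.

Lemma approximation_weak_derivatives eps del a b : admissible L l eps del -> - (eps / 2) <= a ->
  is_weak_derivative a b (A0 eps del) (A1 eps del) /\
  is_weak_derivative a b (A1 eps del) (A2 eps del).
Proof.
move=> adm ea; have [d0 de e0 e1 _] := admissible_pos adm.
split; apply: weak_derivative_primitive => //; [exact: lbm_approximation_slope| |exact: lbm_approximation_density].
by lra.
Qed.

Lemma approximation_sobolev eps del : admissible L l eps del ->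
  sobolev 2 +oo%E (- (del / 2)) (L + del / 2) (A0 eps del).
Proof.
move=> adm; have [d0 de e0 e1 _] := admissible_pos adm.
have [|w1 w2] := @approximation_weak_derivatives eps del (- (del / 2)) (L + del / 2) adm; first lra.
split; first by apply: lbm_Linfty; exact: lbm_approximation.
exists (A1 eps del) => //; split; first by apply: lbm_Linfty; exact: lbm_approximation_slope.
exists (A2 eps del) => //; split => //; by apply: lbm_Linfty; exact: lbm_approximation_density.
Qed.

Let dA eps del := weak_derivative (- (del / 2)) (L + del / 2) (A0 eps del).
Let d2A eps del := weak_derivative (- (del / 2)) (L + del / 2) (dA eps del).

Lemma weak_derivatives_approximation eps del : admissible L l eps del ->
  {ae mu, forall x, - (del / 2) < x < L + del / 2 -> dA eps del x = A1 eps del x} /\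
  (measurable_fun `](- (del / 2)), (L + del / 2)[ (d2A eps del) /\
  {ae mu, forall x, - (del / 2) < x < L + del / 2 -> d2A eps del x = A2 eps del x}).
Proof.
move=> adm; have [d0 de e0 e1 _] := admissible_pos adm.
have [|w1 w2] := @approximation_weak_derivatives eps del (- (del / 2)) (L + del / 2) adm; first lra.
have wd := weak_derivativeP w1.
have e : {ae mu, forall x, - (del / 2) < x < L + del / 2 -> dA eps del x = A1 eps del x}.
  by apply: weak_derivative_unique wd w1; exact: aeW.
split => //; have [|[_ [m2 _ _] _] ?] := weak_derivative_eq e _ w2; last by [].
by case: wd.
Qed.

(** [G1] vanishes up to [l], a node, and so do the jumps at the nodes up to
    [l]; the next strip starts to the right of [l]. *)
Lemma approximation_eq0 : {ae mu, forall x, 0 < x < l -> Phi x = 0} ->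
  {ae mu, forall x, 0 < x < l -> D1 x = 0} ->
  forall eps del, admissible L l eps del ->
  zero_ae (- (del / 2)) l (A0 eps del) /\ zero_ae (- (del / 2)) l (dA eps del).
Proof.
move=> Phi0 D10 eps del adm; have [d0 de e0 e1 _] := admissible_pos adm.
have G1z x : 0 <= x <= l -> G1 x = 0.
  apply: (continuous_ae_eq0 hl G1_continuous).
  move: (ae_and D1G1 D10); apply: ae_mono => y [H1 H2] yl.
  by rewrite -H1 ?H2//; case/andP: yl => -> /lt_trans ->.
have c10 : c1 = 0 by rewrite -(G1_le0 (lexx 0)) G1z// lexx ltW.
have G1l x : x <= l -> G1 x = 0.
  move=> xl; have [x0|/ltW x0] := leP x 0; first by rewrite G1_le0.
  by rewrite G1z// x0.
have [k [_ kl]] : exists k : nat, (0 < k)%N /\ l / eps = k%:R.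
  by case: adm => _ _ _ _ [k k0 kl]; exists k.
have lk : l = eps * k%:~R by rewrite -pmulrn -kl mulrCA divff ?mulr1// gt_eqF.
have A1l x : x <= l -> A1 eps del x = 0.
  rewrite lk; apply: (slope_eq0 d0 de); rewrite -lk; first exact: ltW.
  exact: G1l.
have prim0 (u : R -> R) x : (forall t, t <= l -> u t = 0) -> x <= l ->
    primitive (-1) u x = 0.
  move=> ul xl; rewrite /primitive (@eq_Rintegral _ _ _ _ _ (cst 0)).
    by rewrite Rintegral_cst// mul0r.
  by move=> t; rewrite inE/= in_itv/= => /andP[_ tx]; apply: ul; exact: le_trans xl.
have G0z : G0 l = 0.
  apply: (continuous_ae_eq0 hl G0_continuous); last by rewrite lexx ltW.
  move: (ae_and PhiG0 Phi0); apply: ae_mono => y [H1 H2] yl.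
  by rewrite -H1 ?H2//; case/andP: yl => -> /lt_trans ->.
have c00 : c0 = 0 by rewrite -G0z /G0 prim0 ?addr0.
have [dA1 _] := weak_derivatives_approximation adm.
split.
  by apply: aeW => x /andP[_ /ltW xl]; rewrite /A0 /approximation prim0// c00 addr0.
move: dA1; apply: ae_mono => x H /andP[xd xl].
rewrite H ?A1l ?ltW// xd (lt_trans xl)// (lt_trans hL)// ltrDl divr_gt0//.
Qed.

Lemma cvg0_ereal_near {I : Type} (F : set_system I) (FF : Filter F)
    (f : I -> \bar R) (e : R) :
  f q @[q --> F] --> 0%E -> 0 < e -> \forall q \near F, (f q <= e%:E)%E.
Proof.
move=> f0 e0; have : \forall q \near F, (f q < e%:E)%E.
  apply: (f0 [set x | (x < e%:E)%E]); apply: open_nbhs_nbhs; split; last by rewrite /= lte_fin.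
  exact: open_ereal_lt_ereal.
by apply: filterS => q /ltW.
Qed.

Lemma approximation_cvg_L2 :
  strong_cvg_L2 mu (to_zero L l) `]0, L[ (fun q => A0 q.1 q.2) Phi.
Proof.
have L0 : 0 < L by exact: lt_trans hL.
have mPhi : measurable_fun `]0, L[ Phi by case: wD1 => -[].
have [B B0 G0B] := lbm_bounded_itv 0 L lG0.
have C0 : 0 <= 3 * M * (L + 1) by apply: mulr_ge0; [exact: mulr_ge0|lra].
apply: (@strong_cvg_L2_transfer _ _ _ mu _ _ _ _ (fun q => A0 q.1 q.2) _ (B + 3 * M * (L + 1))).
- exact: measurable_itv.
- exact: itv_finite_measure.
- exact: mPhi.
- move: PhiG0; apply: ae_mono => x H; rewrite /= in_itv/= => xL; rewrite H//.
  case/andP: xL => x0 xL; rewrite (@le_trans _ _ B)//; last by rewrite lerDl.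
  by apply: G0B; rewrite !ltW.
- move=> q adm; have mA0 : measurable_fun `]0, L[ (A0 q.1 q.2).
    by case: (lbm_approximation adm) => + _; exact: measurable_funS.
  split; [exact: mA0|exact: mA0|exact: aeW|].
  apply: aeW => x; rewrite /= in_itv/= => xL.
  have [d0 de e0 e1 _] := admissible_pos adm.
  rewrite -[A0 _ _ _](subrK (G0 x)) (le_trans (ler_normD _ _))// addrC.
  apply: lerD; first by apply: G0B; case/andP: xL => x0 xL; rewrite !ltW.
  rewrite (le_trans (approximation_close adm xL))//.
  rewrite mulrAC ler_piMr//; exact: ltW.
- move: PhiG0; apply: ae_mono => x H; rewrite /= in_itv/= => xL; rewrite H//.
  apply: cvg_sub0; last exact: cvg_cst.
  apply: (@cvg_eps_to_zero _ _ _ (3 * M * (L + 1))) => q adm.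
  by rewrite (le_trans (approximation_close adm xL))// mulrAC.
Qed.

(** The approximation and [G0] have the same constant [c0], so their difference
    is the primitive of the difference of the slopes. *)
Lemma weak_derivative_error eps del : admissible L l eps del ->
  measurable_fun `]0, L[ (weak_derivative 0 L (A0 eps del \- Phi)) /\
  {ae mu, forall x, 0 < x < L ->
    weak_derivative 0 L (A0 eps del \- Phi) x = A1 eps del x - G1 x}.
Proof.
move=> adm; have lA1 := lbm_approximation_slope adm.
have lD : lbm (fun t => A1 eps del t - G1 t).
  split; first by apply: measurable_funB; [case: lA1|case: lG1].
  by move=> B; exists (3 * M * eps) => t _; exact: approximation_slope_close.
have N10 : -1 <= 0 :> R by rewrite lerN10.
have w := weak_derivative_primitive 0 L lD N10.
have [||w' e] := weak_derivative_eq (u := A0 eps del \- Phi) _ _ w.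
- move: PhiG0; apply: ae_mono => x H xL /=; rewrite H// add0r.
  rewrite /primitive RintegralB//; [|exact: lbm_integrable|exact: lbm_integrable].
  by rewrite /A0 /approximation /G0 /primitive; ring.
- apply: locally_integrableB; last by case: wD1.
  by apply: lbm_locally_integrable; exact: lbm_approximation.
- by split => //; case: w' => _ [].
Qed.

Lemma weak_derivative_error_cvg_L2 :
  strong_cvg_L2 mu (to_zero L l) `]0, L[
    (fun q => weak_derivative 0 L (A0 q.1 q.2 \- Phi)) (cst 0).
Proof.
have C0 : 0 <= 3 * M by exact: mulr_ge0.
apply: (@strong_cvg_L2_transfer _ _ _ mu _ _ _ _
  (fun q x => A1 q.1 q.2 x - G1 x) _ (3 * M)) => //.
- exact: itv_finite_measure.
- by apply: aeW => x _; rewrite normr0.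
- move=> q adm; have [mw we] := weak_derivative_error adm.
  have [d0 de e0 e1 _] := admissible_pos adm.
  split => //.
  + by apply: measurable_funB; [case: (lbm_approximation_slope adm)|case: lG1] => + _; exact: measurable_funS.
  + apply: aeW => x _; rewrite (le_trans (approximation_slope_close x adm))// ler_piMr//; exact: ltW.
- apply: aeW => x _; apply: (@cvg_eps_to_zero _ _ _ (3 * M)) => q adm.
  exact: approximation_slope_close.
Qed.

Lemma approximation_cvg_H1 :
  strong_cvg_H1 (to_zero L l) 0 L (fun q => A0 q.1 q.2) Phi.
Proof.
split => //.
- apply: near_to_zero => q adm; have [d0 de e0 e1 _] := admissible_pos adm.
  have [|w1 _] := @approximation_weak_derivatives q.1 q.2 0 L adm; first lra.
  split; first by apply: Linfty_L2; apply: lbm_Linfty; exact: lbm_approximation.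
  exists (A1 q.1 q.2) => //; split => //.
  by apply: Linfty_L2; apply: lbm_Linfty; exact: lbm_approximation_slope.
apply: cvg0_ereal; first by move=> q; exact: poweR_ge0.
move=> e e0; have e2 : 0 < e / 2 by rewrite divr_gt0.
have [_ _ /cvg0_ereal_near/(_ e2) H0] := approximation_cvg_L2.
have [_ _ /cvg0_ereal_near/(_ e2) H1] := weak_derivative_error_cvg_L2.
apply: filterS2 H0 H1 => q h0.
rewrite (_ : _ \- cst 0 = weak_derivative 0 L (A0 q.1 q.2 \- Phi)) => [h1|]; last first.
  by apply/funext => x /=; rewrite subr0.
have sq (x : \bar R) : (0 <= x)%E -> (x <= (e / 2)%:E)%E -> (x ^+ 2 <= ((e / 2) ^+ 2)%:E)%E.
  by move=> x0 xe; rewrite expe2 expr2 EFinM; exact: lee_pmul.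
have -> : e%:E = ((e ^+ 2)%:E `^ 2^-1)%E.
  by rewrite poweR_EFin -powR_mulrn ?ltW// -powRrM mulfV// powRr1// ltW.
have LN0 (u : R -> R) : (0 <= L_norm mu 2%:E (`]0%R, L[)%classic u)%E by exact: Lnorm_ge0.
rewrite /H1_norm; apply: gt0_ler_poweR; rewrite ?invr_ge0 ?in_itv/= ?leey ?andbT//.
- by apply: adde_ge0; apply: mule_ge0.
- by rewrite lee_fin sqr_ge0.
apply: (@le_trans _ _ (((e / 2) ^+ 2)%:E + ((e / 2) ^+ 2)%:E)%E).
  by apply: leeD; [exact: (sq _ (LN0 _) h0)|exact: (sq _ (LN0 _) h1)].
rewrite -EFinD lee_fin; nra.
Qed.

Lemma measurable_cell_fst eps : measurable_fun setT (fun x : R * R => cell eps x.1).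
Proof.
apply: (measurableT_comp (measurable_cell eps (f := fun t => t / eps) _) measurable_fst).
exact: measurable_funM.
Qed.

Lemma approximation_density_bound eps del t : admissible L l eps del -> `|del / eps * A2 eps del t| <= M.
Proof.
move=> adm; have [d0 de e0 e1 _] := admissible_pos adm.
rewrite normrM (gtr0_norm (x := del / eps)) ?divr_gt0//.
have := concentrated_bound M0 G1_lipschitz d0 de t.
rewrite -(ler_pM2l (x := del / eps)) ?divr_gt0//; move=> /le_trans; apply.
by rewrite le_eqVlt; apply/orP; left; apply/eqP; field; rewrite !gt_eqF.
Qed.

Lemma measurable_unfolded eps del s : admissible L l eps del ->
  measurable_fun setT (fun z : (R * R) * (R * R) =>
    del / eps * A2 eps del (cell eps z.1.1 + s * z.2.1)).
Proof.
move=> adm; apply: measurable_funM => //.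
have [mA2 _] := lbm_approximation_density adm.
apply: (measurableT_comp mA2); apply: measurable_funD.
  by apply: (measurableT_comp (measurable_cell_fst eps)); exact: measurable_fst.
apply: measurable_funM => //.
by apply: (measurableT_comp measurable_fst); exact: measurable_snd.
Qed.

Lemma G1_derivable_ae : {ae mu, forall x, 0 < x < L ->
  derivable G1 x 1 /\ G1^`()%classic x = g x}.
Proof.
have lgT : locally_integrable setT g.
  split => //; first exact: openT.
  move=> K _ cK; have mK : measurable K by exact: compact_measurable.
  apply: (@le_lt_trans _ _ (\int[mu]_(x in K) M%:E)%E).
    apply: ge0_le_integral => //=.
    - apply/measurable_EFinP; apply: measurableT_comp => //; exact: measurable_funS mg.
    - by move=> x _; rewrite lee_fin.
  rewrite integral_cst//; apply: lte_mul_pinfty => //.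
  exact: compact_finite_measure.
have ig y : mu.-integrable `]-1, y] (EFin \o g) by exact: lbm_integrable.
have := FTC1 (a := BRight (-1)) ig lgT; apply: ae_mono => x H /andP[x0 _].
have [|dF F'] := H; first by rewrite /= lte_fin; lra.
have dF' : is_derive x 1 (primitive (-1) g) (g x).
  by apply: DeriveDef; [exact: dF|rewrite -derive1E; exact: F'].
have [dG G'] := is_deriveD (is_derive_cst c1 x 1) dF'.
by split; [exact: dG|rewrite derive1E; apply: etrans G' _; rewrite add0r].
Qed.

Lemma unfold2_cvg : strong_cvg_L2 lebesgue_R2R2 (to_zero L l) (omega L `*` Y2)
  (fun q z => q.2 / q.1 * unfold2 q.1 q.2 (of_x1 (d2A q.1 q.2)) z)
  (fun z => of_x1 D2 z.1).
Proof.
have [mD Doo] := @omegaY_finite R L Y2 `](- 2^-1), 2^-1[ `]0, 1[ erefl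
  (itv_finite_measure _ _ _ _) (itv_finite_measure _ _ _ _).
have fst_in (z : (R * R) * (R * R)) : (omega L `*` Y2) z -> 0 < z.1.1 < L.
  by move=> [[+ _] _]; rewrite /= in_itv.
have snd_in (z : (R * R) * (R * R)) : (omega L `*` Y2) z -> `|z.2.1| < 2^-1.
  by move=> [_ [+ _]]; rewrite /= in_itv/= ltr_norml.
apply: (@strong_cvg_L2_transfer _ _ _ (@lebesgue_R2R2 R) _ _ _ _
  (fun q z => q.2 / q.1 * A2 q.1 q.2 (cell q.1 z.1.1 + q.2 * z.2.1)) _ M) => //.
- have mD2 : measurable_fun `]0, L[ D2 by case: wD2 => _ [].
  apply: (@measurable_comp _ _ _ _ _ _ `]0, L[%classic D2 (omega L `*` Y2)
    (fun z : (R * R) * (R * R) => z.1.1)) => //.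
  + by move=> _ [z /fst_in zL <-] /=; rewrite in_itv.
  + have mf : measurable_fun setT (fun z : (R * R) * (R * R) => z.1.1).
      by apply: (measurableT_comp measurable_fst); exact: measurable_fst.
    exact: measurable_funS mf.
- by move: (ae_fst D2g); apply: ae_mono => z H /fst_in zL; rewrite /of_x1 H.
- move=> q adm; have [d0 de e0 e1 _] := admissible_pos adm.
  have [_ [m2 e2]] := weak_derivatives_approximation adm.
  have [|mu_ uw] := unfold_ae_eq (q.2 / q.1) m2 e2 (measurable_cell_fst q.1) d0 mD.
    move=> z Dz; have /andP[x0 xL] := fst_in z Dz.
    have [|c1' c2'] := @cell_bounds R q.1 L z.1.1 e0 _ x0 xL.
      by case: adm.
    have := snd_in z Dz; rewrite ltr_norml => /andP[y1 y2].
    by apply/andP; split; nra.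
  split => //.
  + by have := measurable_unfolded q.2 adm; exact: measurable_funS.
  + by apply: aeW => z _; exact: approximation_density_bound.
- move: (ae_and (ae_fst D2g) (ae_fst G1_derivable_ae)).
  apply: ae_mono => z [H1 H2] Dz; have zL := fst_in z Dz.
  have [dG G'] := H2 zL; rewrite /of_x1 (H1 zL) -G'.
  have := difference_quotient_cvg L l dG.
  apply: cvg_trans; apply: near_eq_cvg; apply: near_to_zero => q adm.
  have [d0 de e0 e1 _] := admissible_pos adm.
  apply/esym; apply: (concentrated_unfold2 _ d0 de).
  exact: snd_in.
Qed.

Lemma unfold1_cvg : strong_cvg_L2 lebesgue_R2R2 (to_zero L l) (omega L `*` Y1)
  (fun q z => q.2 / q.1 * unfold1 q.1 q.2 (of_x1 (d2A q.1 q.2)) z) (cst 0).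
Proof.
have [mD Doo] := @omegaY_finite R L Y1 `]0, 1[ `](- 2^-1), 2^-1[ erefl
  (itv_finite_measure _ _ _ _) (itv_finite_measure _ _ _ _).
have fst_in (z : (R * R) * (R * R)) : (omega L `*` Y1) z -> 0 < z.1.1 < L.
  by move=> [[+ _] _]; rewrite /= in_itv.
have snd_in (z : (R * R) * (R * R)) : (omega L `*` Y1) z -> 0 < z.2.1 < 1.
  by move=> [_ [+ _]]; rewrite /= in_itv.
apply: (@strong_cvg_L2_transfer _ _ _ (@lebesgue_R2R2 R) _ _ _ _
  (fun q z => q.2 / q.1 * A2 q.1 q.2 (cell q.1 z.1.1 + q.1 * z.2.1)) _ M) => //.
- by apply: aeW => z _; rewrite normr0.
- move=> q adm; have [d0 de e0 e1 _] := admissible_pos adm.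
  have [_ [m2 e2]] := weak_derivatives_approximation adm.
  have [|mu_ uw] := unfold_ae_eq (q.2 / q.1) m2 e2 (measurable_cell_fst q.1) e0 mD.
    move=> z Dz; have /andP[x0 xL] := fst_in z Dz.
    have [|c1' c2'] := @cell_bounds R q.1 L z.1.1 e0 _ x0 xL.
      by case: adm.
    have /andP[y1 y2] := snd_in z Dz.
    by apply/andP; split; nra.
  split => //.
  + by have := measurable_unfolded q.1 adm; exact: measurable_funS.
  + by apply: aeW => z _; exact: approximation_density_bound.
- apply: aeW => z Dz; have /andP[y0 y1] := snd_in z Dz.
  apply: cvg_near_cst.
  exists (Num.min z.2.1 (1 - z.2.1)); first by rewrite /= lt_min y0 subr_gt0.
  move=> q /= [adm _ _]; rewrite lt_min => /andP[r1 r2].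
  have [d0 de e0 e1 _] := admissible_pos adm.
  by rewrite /A2 (concentrated_unfold1 _ d0 de)// mulr0.
Qed.

End Approximation.

Theorem lemmaB5 (R : realType) (L l : R) (hl : 0 < l) (hL : l < L)
    (Phi : R -> R) (hPhi : sobolev 2 +oo%E 0 L Phi) :
  exists Phied : R -> R -> R -> R,
    let d2Phi := weak_derivative 0 L (weak_derivative 0 L Phi) in
    let dPhied eps del :=
      weak_derivative (- (del / 2)) (L + del / 2) (Phied eps del) in
    let d2Phied eps del :=
      weak_derivative (- (del / 2)) (L + del / 2) (dPhied eps del) in
    [/\ forall eps del, admissible L l eps del ->
          sobolev 2 +oo%E (- (del / 2)) (L + del / 2) (Phied eps del),
        strong_cvg_H1 (to_zero L l) 0 L (fun q => Phied q.1 q.2) Phi,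
        strong_cvg_L2 lebesgue_R2R2 (to_zero L l) (omega L `*` Y2)
          (fun q z =>
             q.2 / q.1 * unfold2 q.1 q.2 (of_x1 (d2Phied q.1 q.2)) z)
          (fun z => of_x1 d2Phi z.1),
        strong_cvg_L2 lebesgue_R2R2 (to_zero L l) (omega L `*` Y1)
          (fun q z =>
             q.2 / q.1 * unfold1 q.1 q.2 (of_x1 (d2Phied q.1 q.2)) z)
          (cst 0)
      & zero_ae 0 l Phi -> zero_ae 0 l (weak_derivative 0 L Phi) ->
        forall eps del, admissible L l eps del ->
          zero_ae (- (del / 2)) l (Phied eps del) /\
          zero_ae (- (del / 2)) l (dPhied eps del)].
Proof.
have L0 : 0 < L by exact: lt_trans hL.
have [g [M [c0 [c1 [[mg M0 gM g0] wD1 wD2 [D2g D1G1 PhiG0] sPhi]]]]] :=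
  sobolev_representation L0 hPhi.
exists (approximation g c0 c1); split.
- by move=> eps del adm; eapply approximation_sobolev; eassumption.
- exact: (approximation_cvg_H1 hl hL mg M0 gM g0 wD1 PhiG0 sPhi).
- by eapply unfold2_cvg; eassumption.
- by eapply unfold1_cvg; eassumption.
- by eapply approximation_eq0; eassumption.
Qed.
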